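(* Let $G$ be an infinitely edge-connected graph, let $u,v$ be two distinct vertices of $G$, and let $C$ be a component of $G-u-v$ such that both $u$ and $v$ have a neighbour in $C$. Then at least one of the following holds: (i) $G[V(C)\cup\{u,v\}]$ contains a $T_{\aleph_0}*t$ minor; (ii) $G[V(C)\cup\{u,v\}]$ contains a football minor connecting $u$ and $v$.
   Context: Graphs are simple and may be infinite. A graph is infinitely edge-connected if no two distinct vertices can be separated by deleting finitely many edges. $H$ is a minor of $G$ if there are disjoint non-empty vertex sets $V_h\subseteq V(G)$ (branch sets, $h\in V(H)$), each inducing a connected subgraph, with a $V_h$–$V_{h'}$ edge whenever $hh'\in E(H)$. $T_{\aleph_0}$ is the tree with every vertex of countably infinite degree; $T_{\aleph_0}*t$ is obtained by adding a vertex $t$ adjacent to all its vertices. A football with endvertices $u',v'$ is an infinitely edge-connected graph containing $u',v'$ such that deleting $u'$ and $v'$ leaves an infinitely edge-connected graph. A football minor connecting $x$ and $y$ is a football minor with endvertices $u',v'$ such that the branch set of $u'$ contains $x$ and that of $v'$ contains $y$, or vice versa. *)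

(* Defs.v *)
From mathcomp Require Import all_boot.
From mathcomp Require Import boolp classical_sets functions cardinality.
From Stdlib Require Import Relation_Operators.

Set Implicit Arguments.
Unset Strict Implicit.
Unset Printing Implicit Defensive.

Local Open Scope classical_set_scope.

Record graph := Graph {
  vertex :> Type;
  adj : vertex -> vertex -> Prop;
  adj_sym : forall x y, adj x y -> adj y x;
  adj_irrefl : forall x, ~ adj x x
}.

(* An edge is the unordered pair of its ends, encoded as a set of vertices. *)
Definition edges (G : graph) : set (set G) :=
  [set e | exists x y : G, adj x y /\ e = [set x; y]].
Arguments edges : clear implicits.

Section Deletion.
Variable G : graph.

Definition del_edges_adj (F : set (set G)) (x y : G) : Prop :=
  adj x y /\ ~ F [set x; y].

Lemma del_edges_sym F x y : del_edges_adj F x y -> del_edges_adj F y x.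
Proof. by move=> [/adj_sym xy nF]; split=> //; rewrite setUC. Qed.

Lemma del_edges_irrefl F x : ~ del_edges_adj F x x.
Proof. by move=> [/adj_irrefl]. Qed.

Definition del_edges (F : set (set G)) : graph :=
  Graph (@del_edges_sym F) (@del_edges_irrefl F).

Definition induced_adj (A : set G) (x y : {x : G | A x}) : Prop :=
  adj (sval x) (sval y).

Lemma induced_sym A x y : @induced_adj A x y -> @induced_adj A y x.
Proof. exact: adj_sym. Qed.

Lemma induced_irrefl A x : ~ @induced_adj A x x.
Proof. exact: adj_irrefl. Qed.

Definition induced (A : set G) : graph :=
  Graph (@induced_sym A) (@induced_irrefl A).

Definition del_vertices (A : set G) : graph := induced (~` A).

End Deletion.

(* There is a walk, equivalently a path, from [x] to [y]. *)
Definition joined (G : graph) (x y : G) : Prop := clos_refl_trans G (@adj G) x y.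

(* The empty graph is not connected. *)
Definition connected (G : graph) : Prop :=
  [set: G] !=set0 /\ forall x y : G, joined x y.

(* Components are induced subgraphs, so they are given by their vertex sets:
   the maximal vertex sets inducing a connected subgraph. *)
Definition is_component (G : graph) (C : set G) : Prop :=
  connected (induced C) /\
  forall D : set G, C `<=` D -> connected (induced D) -> D = C.

Definition infinitely_edge_connected (G : graph) : Prop :=
  forall x y : G, x <> y ->
  forall F : set (set G), F `<=` edges G -> finite_set F ->
  @joined (del_edges F) x y.

Definition is_model (H G : graph) (B : H -> set G) : Prop :=
  [/\ forall h, B h !=set0,
      trivIset [set: H] B,
      forall h, connected (induced (B h)) &
      forall h h', adj h h' -> exists x y, [/\ B h x, B h' y & adj x y]].

Definition is_minor (H G : graph) : Prop := exists B : H -> set G, is_model B.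

(* [ordS] is the cyclic successor, and a cycle has at least three vertices. *)
Definition acyclic (G : graph) : Prop :=
  ~ exists (n : nat) (c : 'I_n.+3 -> G),
      injective c /\ forall i, adj (c i) (c (ordS i)).

Definition is_tree (T : graph) : Prop := connected T /\ acyclic T.

(* This determines T_{aleph_0} up to isomorphism. *)
Definition is_T_aleph0 (T : graph) : Prop :=
  is_tree T /\ forall x : T, ([set y | adj x y] #= [set: nat])%card.

Section Cone.
Variable G : graph.

Definition cone_adj (x y : option G) : Prop :=
  match x, y with
  | Some a, Some b => adj a b
  | None, None => False
  | _, _ => True
  end.

Lemma cone_sym x y : cone_adj x y -> cone_adj y x.
Proof. by case: x y => [x|] [y|] //=; exact: adj_sym. Qed.

Lemma cone_irrefl x : ~ cone_adj x x.
Proof. by case: x => [x|] //=; exact: adj_irrefl. Qed.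

(* The graph [G * t], where the new vertex [t] is [None]. *)
Definition cone : graph := Graph cone_sym cone_irrefl.

End Cone.

Definition has_T_aleph0_t_minor (G : graph) : Prop :=
  exists T : graph, is_T_aleph0 T /\ is_minor (cone T) G.

(* The ends must be distinct: otherwise the one-vertex graph would qualify. *)
Definition is_football (F : graph) (a b : F) : Prop :=
  [/\ a <> b,
      infinitely_edge_connected F &
      infinitely_edge_connected (del_vertices [set a; b])].

Definition has_football_minor_connecting (G : graph) (x y : G) : Prop :=
  exists (F : graph) (a b : F) (B : F -> set G),
    [/\ is_football a b,
        is_model B &
        (B a x /\ B b y) \/ (B a y /\ B b x)].

Section Attached.
Variables (G : graph) (u v : G) (C : set (del_vertices [set u; v])).

(* The vertex set V(C) ∪ {u, v}, as a subset of V(G). *)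
Definition with_ends : set G := (sval @` C) `|` [set u; v].

Lemma with_ends_l : with_ends u.
Proof. by right; left. Qed.

Lemma with_ends_r : with_ends v.
Proof. by right; right. Qed.

Definition endl : induced with_ends := exist _ u with_ends_l.
Definition endr : induced with_ends := exist _ v with_ends_r.

End Attached.

(* Main.v *)
(* Call a set D tied to p if no vertex of D is finitely separable from p in
   D + p. Suppose D is connected and tied to p, and r is in D. If some connected
   K in D containing r has infinitely many disjoint connected neighbours E_n that
   are tied to p, then K can serve as the branch set of a tree vertex of
   T_aleph0, with the E_n carrying its subtrees and p in the branch set of t.
   Otherwise r is "tight". Then every vertex of the class R of vertices not
   finitely separable from r in D has only finitely many neighbours in D - R, and
   D - R can be distributed over R in connected pieces with finite boundary;
   contracting these gives an infinitely edge-connected minor on R in which p has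
   infinitely many neighbours. The component Y of p in R + p - r is tied to r, so
   the alternative applies again with the roles of p and r exchanged. If p is not
   tight in Y, one obtains infinitely many smaller pairs (p_i, r_i), with p_i
   attached on the side of p and r_i on the side of r. If p is tight, contracting
   once more leaves, besides p and r, a set S tied to both. Either S has a
   nonempty subset of finite boundary that is minimal up to finite cuts, which
   with p and r forms a football, or S splits into infinitely many disjoint sets
   tied to both, again giving smaller pairs. If no football ever occurs, iterating
   builds T_aleph0 * t.

   Graphs are given as a relation on a fixed type together with a set of
   vertices, so that iterated minors stay on the same type. *)

Require Import Defs.
From mathcomp Require Import all_boot.
From mathcomp Require Import boolp classical_sets functions cardinality.

Set Implicit Arguments.
Unset Strict Implicit.
Unset Printing Implicit Defensive.

Local Open Scope classical_set_scope.

(** * Connectedness and finite cuts *)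

Lemma finite_set_inj (T U : Type) (A : set T) (B : set U) (f : T -> U) :
  (forall x, A x -> B (f x)) ->
  (forall x y, A x -> A y -> f x = f y -> x = y) ->
  finite_set B -> finite_set A.
Proof.
move=> AB fI fB; apply: (@sub_finite_set _ _
  (\bigcup_(y in B) [set x | A x /\ f x = y])).
  by move=> x Ax; exists (f x) => //; exact: AB.
apply: bigcup_finite => // y _.
have [[x [Ax <-]]|n] := pselect (exists x, A x /\ f x = y).
  by apply: (@sub_finite_set _ _ [set x]) => // z [Az /fI->].
suff -> : [set x | A x /\ f x = y] = set0 by exact: finite_set0.
by rewrite -subset0 => x hx; apply: n; exists x.
Qed.

Section Graphs.
Variable V : Type.

Definition symr (e : V -> V -> Prop) := forall x y, e x y -> e y x.

Definition disj (A B : set V) := forall x, A x -> B x -> False.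

Definition touch (e : V -> V -> Prop) (A B : set V) :=
  exists a b, [/\ A a, B b & e a b].

Definition cut (e : V -> V -> Prop) (A B : set V) : set (V * V) :=
  [set z | [/\ A z.1, B z.2 & e z.1 z.2]].

(** Connectedness is an induction principle along the edges inside [A], so that few later arguments
    need paths. *)
Definition conn (e : V -> V -> Prop) (A : set V) :=
  A !=set0 /\ forall (B : set V) x, A x -> B x ->
    (forall a b, A a -> B a -> A b -> e a b -> B b) -> A `<=` B.

Definition compon (e : V -> V -> Prop) (A : set V) (x : V) : set V :=
  [set y | exists S, [/\ S `<=` A, conn e S, S x & S y]].

(** These sets form a Boolean algebra under complement in [D], hence the name; they stand for the
    finite cuts of [D]. *)
Definition clopen (e : V -> V -> Prop) (D A : set V) :=
  A `<=` D /\ finite_set (cut e A (D `\` A)).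

Lemma touch_cut (e : V -> V -> Prop) (A B : set V) :
  infinite_set (cut e A B) -> touch e A B.
Proof.
move=> h; apply: contrapT => n; apply: h.
suff -> : cut e A B = set0 by exact: finite_set0.
by rewrite -subset0 => -[a b] [/= *]; apply: n; exists a, b.
Qed.

Lemma finite_cut_sym (e : V -> V -> Prop) (A B : set V) :
  symr e -> finite_set (cut e A B) -> finite_set (cut e B A).
Proof.
move=> es h; apply: sub_finite_set (finite_image (fun z => (z.2, z.1)) h).
by move=> [a b] [/= Ba Ab ab]; exists (b, a) => //; split=> //=; exact: es.
Qed.

Lemma cutS (e : V -> V -> Prop) (A B A' B' : set V) :
  A `<=` A' -> B `<=` B' -> cut e A B `<=` cut e A' B'.
Proof. by move=> AA BB [a b] [/= /AA ? /BB ? ?]. Qed.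

(** The stage number is passed to [Rl] so that a construction can work through an enumeration; a
    removed set may be empty. Choosing [Q] for every pair of a number and a set turns the
    construction into plain iteration. *)
Lemma peel (Inv : set V -> Prop) (Rl : nat -> set V -> set V -> Prop)
    (D0 : set V) :
  Inv D0 ->
  (forall n D, Inv D -> exists Q, [/\ Q `<=` D, Rl n D Q & Inv (D `\` Q)]) ->
  exists Ds Q : nat -> set V,
    [/\ Ds 0 = D0, forall n, Ds n.+1 = Ds n `\` Q n, forall n, Inv (Ds n),
        forall n, Q n `<=` Ds n & forall n, Rl n (Ds n) (Q n)].
Proof.
move=> I0 step.
have /choice[f fP] (nD : nat * set V) : exists Q, Inv nD.2 ->
    [/\ Q `<=` nD.2, Rl nD.1 nD.2 Q & Inv (nD.2 `\` Q)].
  by have [/step-/(_ nD.1)[Q]|?] := pselect (Inv nD.2); [exists Q|exists set0].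
pose Ds := fix Ds n := if n is n'.+1 then Ds n' `\` f (n', Ds n') else D0.
have IDs n : Inv (Ds n) by elim: n => //= n /(fP (n, _))[].
by exists Ds, (fun n => f (n, Ds n)); split=> // n; have [] := fP (n, _) (IDs n).
Qed.

Lemma peel_decr (Ds Q : nat -> set V) :
  (forall n, Ds n.+1 = Ds n `\` Q n) -> forall m n, m <= n -> Ds n `<=` Ds m.
Proof.
move=> DS m n /subnK <-; elim: (n - m) => // k IH x.
by rewrite addSn DS => -[/IH].
Qed.

Lemma peel_disj (Ds Q : nat -> set V) :
  (forall n, Ds n.+1 = Ds n `\` Q n) -> (forall n, Q n `<=` Ds n) ->
  forall m n, m <> n -> disj (Q m) (Q n).
Proof.
move=> DS QD.
have lt m n : m < n -> disj (Q m) (Q n).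
  move=> mn x Qm /QD/(peel_decr DS mn).
  by rewrite DS => -[].
move=> m n /eqP; rewrite neq_ltn => /orP[/lt//|/lt h x Qm Qn].
exact: h Qn Qm.
Qed.

Section Relation.
Variables (e : V -> V -> Prop) (es : symr e).
Implicit Types A B C D K Q R S : set V.

Lemma touch_sym A B : touch e A B -> touch e B A.
Proof. by move=> [a [b [? ? /es]]]; exists b, a. Qed.

Lemma touchS A B A' B' : A `<=` A' -> B `<=` B' -> touch e A B -> touch e A' B'.
Proof. by move=> AA BB [a [b [/AA ? /BB ? ?]]]; exists a, b. Qed.

Lemma conn_touch A B : conn e A -> B `&` A !=set0 -> A `\` B !=set0 ->
  touch e (A `&` B) (A `\` B).
Proof.
move=> [_ cA] [x [Bx Ax]] [y [Ay nBy]]; apply: contrapT => n; apply: nBy.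
apply: (cA B x) => // a b Aa Ba Ab ab; apply: contrapT => nBb.
by apply: n; exists a, b.
Qed.

(** For a symmetric relation the complement of a closed set is closed again, so one base vertex
    suffices. *)
Lemma conn_intro A x : A x ->
  (forall B, B x -> (forall a b, A a -> B a -> A b -> e a b -> B b) ->
     A `<=` B) -> conn e A.
Proof.
move=> Ax h; split; first by exists x.
move=> B y Ay By cl; apply: (h B) => //; apply: contrapT => nBx.
apply: (h (~` B)) Ay By => // a b Aa nBa Ab ab Bb.
by apply: nBa; apply: (cl b a) => //; exact: es.
Qed.

Lemma conn1 x : conn e [set x].
Proof. by apply: (@conn_intro _ x) => // B Bx _ _ ->. Qed.

Lemma connU_meet A B x : conn e A -> conn e B -> A x -> B x -> conn e (A `|` B).
Proof.
move=> [_ cA] [_ cB] Ax Bx; apply: (@conn_intro _ x); first by left.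
move=> C Cx cl y [Ay|By].
  by apply: (cA C x) Ay => // a b *; apply: (cl a b) => //; left.
by apply: (cB C x) By => // a b *; apply: (cl a b) => //; right.
Qed.

Lemma connU A B : conn e A -> conn e B -> touch e A B -> conn e (A `|` B).
Proof.
move=> [_ cA] [_ cB] [x [y [Ax By xy]]]; apply: (@conn_intro _ x); first by left.
move=> C Cx cl.
have Cy : C y by apply: (cl x y) => //; [left|right].
move=> z [Az|Bz].
  by apply: (cA C x) Az => // a b *; apply: (cl a b) => //; left.
by apply: (cB C y) Bz => // a b *; apply: (cl a b) => //; right.
Qed.

Lemma conn_bigcup (I : Type) (P : set I) (F : I -> set V) x :
  P !=set0 -> (forall i, P i -> conn e (F i) /\ F i x) ->
  conn e (\bigcup_(i in P) F i).
Proof.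
move=> [i0 Pi0] h; apply: (@conn_intro _ x); first by exists i0; have [] := h _ Pi0.
move=> C Cx cl y [i Pi Fy]; have [[_ cF] Fx] := h _ Pi.
by apply: (cF C x) Fy => // a b *; apply: (cl a b) => //; exists i.
Qed.

Lemma compon_sub A x : compon e A x `<=` A.
Proof. by move=> y [S [SA _ _ /SA]]. Qed.

Lemma compon_refl A x : A x -> compon e A x x.
Proof. by move=> Ax; exists [set x]; split=> //; [move=> _ ->|exact: conn1]. Qed.

Lemma conn_compon A x : A x -> conn e (compon e A x).
Proof.
move=> Ax.
have -> : compon e A x =
    \bigcup_(S in [set S | [/\ S `<=` A, conn e S & S x]]) S.
  apply/seteqP; split=> y; first by move=> [S [*]]; exists S.
  by move=> [S [*]]; exists S.
apply: (@conn_bigcup _ _ _ x) => [|S []//].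
by exists [set x]; split=> //; [move=> _ ->|exact: conn1].
Qed.

Lemma compon_max A x S y : conn e S -> S `<=` A -> S y -> compon e A x y ->
  S `<=` compon e A x.
Proof.
move=> cS SA Sy [T [TA cT Tx Ty]] z Sz; exists (S `|` T); split.
- by move=> w [/SA|/TA].
- exact: connU_meet Sy Ty.
- by right.
- by left.
Qed.

Lemma compon_closed A x a b : compon e A x a -> A b -> e a b -> compon e A x b.
Proof.
move=> ca Ab ab; apply: (@compon_max A x [set a; b] a) => //; last by right.
- by apply: connU; [exact: conn1|exact: conn1|exists a, b].
- by move=> _ [->|->//]; exact: compon_sub ca.
- by left.
Qed.

(** Distinct components of [D \ K] are not adjacent, so what remains beside [K] still reaches [K]
    without the removed component. *)
Lemma conn_setD_compon D K x : conn e D -> K `<=` D -> conn e K ->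
  conn e (D `\` compon e (D `\` K) x).
Proof.
move=> cD KD [[k Kk] cK]; set A := compon _ _ _.
have kA : ~ A k by move=> /compon_sub[].
apply: (@conn_intro _ k); first by split=> //; exact: KD.
move=> B Bk cl.
have KB : K `<=` B.
  apply: (cK B k) => // a b Ka Ba Kb ab; apply: (cl a b) => //.
    by split; [exact: KD|move=> /compon_sub[]].
  by split; [exact: KD|move=> /compon_sub[]].
move=> y [Dy nAy]; apply: contrapT => nBy.
have [||a [b [[Da [nBa nAa]] [Db nb] ab]]] :=
    @conn_touch D [set z | ~ B z /\ ~ A z] cD.
- by exists y.
- by exists k; split=> [|[]//]; exact: KD.
have [Ab|nAb] := pselect (A b).
  by apply: nAa; apply: (@compon_closed _ _ b a) => //; [split=> // /KB|exact: es].
have [Bb|nBb] := pselect (B b); last exact: nb.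
by apply: nBa; apply: (cl b a) => //; exact: es.
Qed.

Lemma clopenD_compl D A : A `<=` D -> clopen e D A -> clopen e D (D `\` A).
Proof.
move=> AD [_ fA]; split; first by move=> x [].
by rewrite setDD (setIidr AD); exact: finite_cut_sym.
Qed.

Lemma clopen0 D : clopen e D set0.
Proof.
split=> //; suff -> : cut e set0 (D `\` set0) = set0 by exact: finite_set0.
by rewrite -subset0 => z [].
Qed.

Lemma clopenT D : clopen e D D.
Proof.
split=> //; suff -> : cut e D (D `\` D) = set0 by exact: finite_set0.
by rewrite -subset0 => z [_ []].
Qed.

Lemma clopenI D A B : clopen e D A -> clopen e D B -> clopen e D (A `&` B).
Proof.
move=> [AD fA] [BD fB]; split; first by move=> x [/AD].
apply: (@sub_finite_set _ _ (cut e A (D `\` A) `|` cut e B (D `\` B))).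
  move=> [a b] [/= [Aa Ba] [Db nb] ab].
  have [Ab|nAb] := pselect (A b); last by left.
  by right; split=> //; split=> // Bb; apply: nb.
by rewrite finite_setU.
Qed.

Lemma clopenD D A B : clopen e D A -> clopen e D B -> clopen e D (A `\` B).
Proof.
move=> cA cB; have [AD _] := cA; have [BD _] := cB.
have -> : A `\` B = A `&` (D `\` B).
  by apply/seteqP; split=> x; [move=> [Ax nBx]; do 2 split=> //; exact: AD|move=> [? []]].
by apply: clopenI => //; exact: clopenD_compl.
Qed.

Lemma clopenU D A B : clopen e D A -> clopen e D B -> clopen e D (A `|` B).
Proof.
move=> [AD fA] [BD fB]; split; first by move=> x [/AD|/BD].
apply: (@sub_finite_set _ _ (cut e A (D `\` A) `|` cut e B (D `\` B))).
  move=> [a b] [/= [Aa|Ba] [Db nb] ab]; [left|right]; split=> //; split=> // ?.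
    by apply: nb; left.
  by apply: nb; right.
by rewrite finite_setU.
Qed.

Lemma clopen_trans D D' A : clopen e D D' -> clopen e D' A -> clopen e D A.
Proof.
move=> [DD fD] [AD fA]; split; first by move=> x /AD/DD.
apply: (@sub_finite_set _ _ (cut e A (D' `\` A) `|` cut e D' (D `\` D'))).
  move=> [a b] [/= Aa [Db nb] ab].
  have [Db'|nDb'] := pselect (D' b); first by left.
  by right; split=> //; exact: AD.
by rewrite finite_setU.
Qed.

Lemma clopen_restr D D' A : D' `<=` D -> clopen e D A -> clopen e D' (A `&` D').
Proof.
move=> DD [AD fA]; split; first by move=> x [].
apply: sub_finite_set fA => -[a b] [/= [Aa D'a] [D'b nb] ab].
by split=> //; split; [exact: DD|move=> Ab; apply: nb].
Qed.

(** An edge that leaves the component within [D] also leaves [A]. *)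
Lemma clopen_compon D A x : clopen e D A -> A x -> clopen e D (compon e A x).
Proof.
move=> [AD fA] Ax; split; first by move=> y /compon_sub/AD.
apply: sub_finite_set fA => -[a b] [/= ca [Db nb] ab].
split=> //; first exact: compon_sub ca.
by split=> // Ab; apply: nb; exact: compon_closed ab.
Qed.

Lemma clopen_bigcup (I : Type) D (P : set I) (F : I -> set V) :
  finite_set P -> (forall i, P i -> clopen e D (F i)) ->
  clopen e D (\bigcup_(i in P) F i).
Proof.
move=> fP h; split; first by move=> x [i /h[FD _] /FD].
apply: (@sub_finite_set _ _ (\bigcup_(i in P) cut e (F i) (D `\` F i))).
  move=> [a b] [/= [i Pi Fa] [Db nb] ab]; exists i => //.
  by split=> //; split=> // Fb; apply: nb; exists i.
by apply: bigcup_finite => // i /h[].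
Qed.

End Relation.

(** * Tied sets and tight vertices *)

Definition tied (e : V -> V -> Prop) (p : V) (D : set V) :=
  forall A, A `<=` D -> A !=set0 -> infinite_set (cut e A ((D `\` A) `|` [set p])).

Definition conn_tied (e : V -> V -> Prop) (p : V) (D : set V) :=
  [/\ conn e D, tied e p D & ~ D p].

Definition insep (e : V -> V -> Prop) (D R : set V) :=
  forall A x y, clopen e D A -> R x -> R y -> A x -> A y.

Definition insep_class (e : V -> V -> Prop) (D : set V) (r : V) : set V :=
  [set x | D x /\ forall A, clopen e D A -> A r -> A x].

(* The vertex [r] of [D] can be expanded towards a tree vertex, with apex [p]. *)
Definition nontight (e : V -> V -> Prop) (p : V) (D : set V) (r : V) :=
  exists K (E : nat -> set V),
  [/\ conn e K, K r, K `<=` D, forall m n, m <> n -> disj (E m) (E n) &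
      forall n, [/\ conn_tied e p (E n), E n `<=` D, disj K (E n) & touch e K (E n)]].

(** Values outside [D] are allowed, so a subset inherits the same enumeration. *)
Definition enumerable (D : set V) := exists f : nat -> V, D `<=` range f.

Definition blow (Z : V -> set V) (x : V) : set V := [set x] `|` Z x.

(* The set [D] is distributed over the inseparable set [R]: the vertex [x] of [R]
   absorbs the piece [Z x]. *)
Definition ystruct (e : V -> V -> Prop) (D R : set V) (Z : V -> set V) :=
  [/\ R `<=` D /\ insep e D R,
      forall x y, Z x y -> [/\ R x, D y & ~ R y],
      forall x x' y, Z x y -> Z x' y -> x = x',
      forall x, R x -> clopen e D (Z x) /\ conn e (blow Z x) &
      forall y, D y -> ~ R y -> exists x, Z x y].

(** Contraction may create loops, so [model] asks about distinct vertices only, and [simple_adj]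
    removes the loops at the end. *)
Definition quo (e : V -> V -> Prop) (W : V -> set V) (x y : V) :=
  touch e (W x) (W y).

(** Infinite edge-connectivity of the graph on [X], in terms of cuts. *)
Definition icut (e : V -> V -> Prop) (X : set V) :=
  forall A, A `<=` X -> A !=set0 -> X `\` A !=set0 -> infinite_set (cut e A (X `\` A)).

Section Structure.
Variables (e : V -> V -> Prop) (es : symr e).
Implicit Types A B C D K Q R S : set V.

Lemma tied_clopen p D A : tied e p D -> clopen e D A -> tied e p A.
Proof.
move=> gD [AD fA] B BA B0 fB.
have BD : B `<=` D by move=> x /BA/AD.
apply: (gD B BD B0).
apply: (@sub_finite_set _ _
  (cut e B ((A `\` B) `|` [set p]) `|` cut e A (D `\` A))).
  move=> [a b] [/= Ba H ab].
  have [Ab|nAb] := pselect (A b).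
    by left; split=> //; case: H => [[_ nb]|->]; [left|right].
  case: H => [[Db _]|H].
    by right; split=> //; exact: BA.
  by left; split=> //; right.
by rewrite finite_setU.
Qed.

(** Infinitely many edges leave [A] in [D + p], and only finitely many of them end in [D]. *)
Lemma tied_touch p D A : tied e p D -> clopen e D A -> A !=set0 ->
  infinite_set (cut e A [set p]).
Proof.
move=> gD cA A0; have := tied_clopen gD cA (@subset_refl _ A) A0.
by rewrite setDv set0U.
Qed.

Lemma insep_class_sub D r : insep_class e D r `<=` D.
Proof. by move=> x []. Qed.

Lemma insep_class_refl D r : D r -> insep_class e D r r.
Proof. by []. Qed.

Lemma insep_class_insep D r : D r -> insep e D (insep_class e D r).
Proof.
move=> Dr A x y cA [Dx hx] [Dy hy] Ax.
have [Ar|nAr] := pselect (A r); first exact: hy.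
by have [] := hx (D `\` A) (clopenD_compl es cA.1 cA) (conj Dr nAr).
Qed.

Lemma insep_class_sep D r w : D w -> ~ insep_class e D r w ->
  exists Q, [/\ clopen e D Q, Q w & disj Q (insep_class e D r)].
Proof.
move=> Dw nw; apply: contrapT => nQ; apply: nw; split=> // A cA Ar.
apply: contrapT => nAw; apply: nQ; exists (D `\` A); split=> //.
  exact: (clopenD_compl es cA.1 cA).
by move=> x [_ nAx] [_ /(_ A cA Ar)].
Qed.

(* A disguised finiteness notion: only finitely many members of a disjoint
   sequence can meet [K]. *)
Definition meagre K := forall E : nat -> set V,
  (forall m n, m <> n -> disj (E m) (E n)) ->
  exists N, forall n, N <= n -> disj K (E n).

Lemma meagre1 x : meagre [set x].
Proof.
move=> E dE; have [[m Em]|n] := pselect (exists m, E m x); last first.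
  by exists 0 => k _ _ -> Ek; apply: n; exists k.
exists m.+1 => k mk _ -> Ek; apply: (dE m k) Em Ek => h.
by rewrite h ltnn in mk.
Qed.

Lemma meagreU A B : meagre A -> meagre B -> meagre (A `|` B).
Proof.
move=> mA mB E dE; have [N hN] := mA E dE; have [M hM] := mB E dE.
by exists (maxn N M) => n; rewrite geq_max => /andP[/hN dA /hM dB] x [/dA|/dB].
Qed.

(** A substitute for a finite path: [K] grows by one vertex at a time, and a vertex meets at most
    one member of a disjoint sequence. *)
Lemma conn_meagre D x y : conn e D -> D x -> D y ->
  exists K, [/\ conn e K, meagre K, K x, K y & K `<=` D].
Proof.
move=> [_ cD] Dx.
pose G := [set y | exists K, [/\ conn e K, meagre K, K x, K y & K `<=` D]].
move: y; apply: (cD G x) => //.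
  by exists [set x]; split=> //; [exact: conn1|exact: meagre1|move=> _ ->].
move=> a b Da [K [cK mK Kx Ka KD]] Db ab; exists (K `|` [set b]); split.
- by apply: connU => //; [exact: conn1|exists a, b].
- by apply: meagreU => //; exact: meagre1.
- by left.
- by right.
- by move=> z [/KD|->].
Qed.

(* Otherwise disjoint clopen sets could be split off around infinitely many
   outer neighbours of [x] one at a time, so that [r] would not be tight. *)
Lemma tight_finite p D r x : conn e D -> tied e p D -> ~ D p -> D r ->
  ~ nontight e p D r -> insep_class e D r x ->
  finite_set [set w | [/\ D w, ~ insep_class e D r w & e x w]].
Proof.
move=> cD gD nDp Dr tight Rx; apply: contrapT => inf; apply: tight.
pose R := insep_class e D r.
pose Inv D' := [/\ clopen e D D', D' x &
  infinite_set [set w | [/\ D' w, ~ R w & e x w]]].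
pose Rl (_ : nat) (_ Q : set V) :=
  [/\ clopen e D Q, conn e Q, disj Q R & exists2 w, Q w & e x w].
have Dx : D x := Rx.1.
have I0 : Inv D by split=> //; exact: clopenT.
have [n D' [cD' D'x inf']|Ds [Q [_ DS IDs QD RQ]]] := @peel Inv Rl _ I0.
  have [w [D'w nRw xw]] : exists w, [/\ D' w, ~ R w & e x w].
    apply: contrapT => n'; apply: inf'.
    suff -> : [set w | [/\ D' w, ~ R w & e x w]] = set0 by exact: finite_set0.
    by rewrite -subset0 => w hw; apply: n'; exists w.
  have [Q0 [cQ0 Q0w dQ0]] := insep_class_sep (cD'.1 _ D'w) nRw.
  have cI := clopenI cQ0 cD'.
  have cQ : clopen e D (compon e (Q0 `&` D') w) by exact: clopen_compon.
  have nQx : ~ compon e (Q0 `&` D') w x by move=> /compon_sub[/dQ0].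
  exists (compon e (Q0 `&` D') w); split.
  - by move=> y /compon_sub[].
  - split=> //; first by apply: conn_compon.
      by move=> y /compon_sub[/dQ0].
    by exists w => //; exact: compon_refl.
  - split=> //; first exact: clopenD.
    (* [x] lies outside the removed component, whose boundary is finite, so only finitely many
       neighbours of [x] are lost. *)
    apply: contra_not inf' => fin.
    apply: (@sub_finite_set _ _ ([set w0 | [/\ (D' `\` compon e (Q0 `&` D') w) w0,
      ~ R w0 & e x w0]] `|` [set z.1 | z in
        cut e (compon e (Q0 `&` D') w) (D `\` compon e (Q0 `&` D') w)])).
      move=> y [D'y nRy xy].
      have [Qy|nQy] := pselect (compon e (Q0 `&` D') w y); last by left.
      by right; exists (y, x) => //; split=> //; exact: es.
    by rewrite finite_setU; split=> //; apply: finite_image; exact: cQ.2.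
have dQ := peel_disj DS QD.
(* The connection from [r] to [x] avoids all [Q n] with [n >= N]; shifting the index discards the
   others. *)
have [K [cK mK Kr Kx KD]] := conn_meagre cD Dr Dx.
have [N hN] := mK _ dQ.
exists K, (fun n => Q (n + N)); split=> //.
  by move=> m n mn; apply: dQ => /addIn.
move=> n; have [cQ ccQ dQR [w Qw xw]] := RQ (n + N); split=> //.
- by split=> //; [exact: tied_clopen cQ|move=> /cQ.1].
- exact: cQ.1.
- by apply: hN; rewrite leq_addl.
- by exists x, w.
Qed.

(* The piece is the complement of the component of [D \ K] that contains [R],
   where [K] is connected, clopen, and reaches from [w] to a neighbour of [R]. *)
Lemma piece D R w : conn e D -> R `<=` D -> R !=set0 -> insep e D R ->
  (forall w, D w -> ~ R w ->
     exists Q, [/\ clopen e D Q, Q w & disj Q R]) ->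
  D w -> ~ R w ->
  exists P, [/\ clopen e D P /\ P w, disj P R, conn e P, touch e R P &
    conn e (D `\` P)].
Proof.
move=> cD RD [x0 Rx0] iR sep0 Dw nRw.
have sep y : D y -> ~ R y ->
    exists Q, [/\ clopen e D Q, conn e Q, Q y & disj Q R].
  move=> Dy /(sep0 _ Dy)[Q [cQ Qy dQ]]; exists (compon e Q y); split.
  - exact: clopen_compon.
  - exact: conn_compon.
  - exact: compon_refl.
  - by move=> z /compon_sub; exact: dQ.
pose G := [set y | exists K, [/\ clopen e D K /\ disj K R, conn e K, K w & K y]].
(* If [G] did not touch [R], it would be closed under adjacency in the connected set [D] and hence
   contain [R], which every such [K] avoids. *)
have [y [x [[K [[cK dK] ccK Kw Ky]] Rx yx]]] : touch e G R.
  apply: contrapT => nt.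
  have [Q [cQ ccQ Qw dQ]] := sep _ Dw nRw.
  have Gw : G w by exists Q.
  suff /(_ _ (RD _ Rx0)) [K [[_ dK] _ _ /dK]] : D `<=` G by exact.
  apply: (cD.2 G w) => // a b Da [K [[cK dK] ccK Kw Ka]] Db ab.
  have nRb : ~ R b by move=> Rb; apply: nt; exists a, b; split=> //; exists K.
  have [Q' [cQ' ccQ' Q'b dQ']] := sep _ Db nRb.
  exists (K `|` Q'); split.
  - by split; [exact: clopenU|move=> z [/dK|/dQ']].
  - by apply: connU => //; exists a, b.
  - by left.
  - by right.
pose A := compon e (D `\` K) x0.
have DKx0 : (D `\` K) x0 by split; [exact: RD|move=> /dK; exact].
have cA : clopen e D A by apply: clopen_compon => //; exact: (clopenD_compl es cK.1).
have RA : R `<=` A by move=> z Rz; apply: (iR A x0 z) => //; exact: compon_refl.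
have KA z : K z -> ~ A z by move=> Kz /compon_sub[].
exists (D `\` A); split.
- split; first exact: (clopenD_compl es cA.1 cA).
  by split=> //; exact: KA.
- by move=> z [_ nAz] /RA.
- exact: (@conn_setD_compon _ es _ _ x0 cD cK.1 ccK).
- exists x, y; split=> //; last exact: es.
  by split; [exact: cK.1|exact: KA].
- by rewrite setDD (setIidr cA.1); exact: conn_compon.
Qed.

(** At stage [n] a piece around the [n]-th vertex is removed, unless that vertex is already gone or
    lies in [R]; the rest stays connected. Each nonempty piece is given to a vertex of [R] with an
    edge into it. Different pieces given to [x] contain different outer neighbours of [x], so they
    are finitely many and their union is clopen. *)
Lemma piece_assign D r : conn e D -> enumerable D -> D r ->
  (forall x, insep_class e D r x ->
     finite_set [set w | [/\ D w, ~ insep_class e D r w & e x w]]) ->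
  exists Z, ystruct e D (insep_class e D r) Z.
Proof.
move=> cD [en enD] Dr fin; pose R := insep_class e D r.
have RD : R `<=` D := @insep_class_sub D r.
have iR : insep e D R := insep_class_insep Dr.
pose Inv D' := [/\ clopen e D D', conn e D' & R `<=` D'].
pose Rl n (D' P : set V) := [/\ D' (en n) -> ~ R (en n) -> P (en n),
  clopen e D P, disj P R & P !=set0 -> conn e P /\ touch e R P].
have I0 : Inv D by split=> //; exact: clopenT.
have [n D' [cD' ccD' RD']|Ds [P [D0 DS IDs PD RP]]] := @peel Inv Rl _ I0.
  have [[D'n nRn]|nn] := pselect (D' (en n) /\ ~ R (en n)); last first.
    exists set0; rewrite setD0; split=> //; split=> //.
    - by move=> h1 h2; apply: nn.
    - exact: clopen0.
    - by case.
  have iR' : insep e D' R.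
    by move=> A x y /(clopen_trans cD'); exact: iR.
  have [||Q [[cQ Qn] dQ ccQ tQ ccDQ]] := piece ccD' RD' _ iR' _ D'n nRn.
  - by exists r; exact: insep_class_refl.
  - move=> w D'w nRw; have [Q [cQ Qw dQ]] := insep_class_sep (cD'.1 _ D'w) nRw.
    exists (Q `&` D'); split=> //; first exact: (clopen_restr cD'.1 cQ).
    by move=> z [/dQ].
  - have cDQ := clopen_trans cD' cQ.
    exists Q; split; [exact: cQ.1|by split|split=> //; first exact: clopenD].
    by move=> z Rz; split; [exact: RD'|move=> /dQ; exact].
have dP := peel_disj DS PD.
(* The pair [(r, r)] is a dummy value for empty pieces. *)
have /choice[rw rwP] n : exists rw : V * V, P n !=set0 ->
    [/\ R rw.1, P n rw.2 & e rw.1 rw.2].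
  have [n0|n0] := pselect (P n !=set0); last by exists (r, r).
  by have [_ _ _ /(_ n0)[_ [x [y ?]]]] := RP n; exists (x, y).
have Pinj m n x : P m x -> P n x -> m = n.
  move=> Pm Pn; apply: contrapT => mn; exact: dP mn _ Pm Pn.
exists (fun x => [set y | exists2 n, P n y & (rw n).1 = x]); split.
- by [].
- move=> x y [n Pny <-]; have [|Rx _ _] := rwP n; first by exists y.
  have [_ cP dPR _] := RP n; split=> //; [exact: cP.1|exact: dPR].
- by move=> x x' y [n Pn <-] [m Pm <-]; rewrite (Pinj _ _ _ Pn Pm).
- move=> x Rx; pose N := [set n | P n !=set0 /\ (rw n).1 = x].
  have fN : finite_set N.
    apply: (finite_set_inj (f := fun n => (rw n).2)) (fin x Rx).
      move=> n [Pn0 <-]; have [Rr Pw rw'] := rwP _ Pn0; have [_ cP dPR _] := RP n.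
      by split=> //; [exact: cP.1|exact: dPR].
    move=> m n [/rwP[_ Pm _] _] [/rwP[_ Pn _] _] E; apply: (Pinj _ _ _ Pm).
    by rewrite E.
  have EZ : [set y | exists2 n, P n y & (rw n).1 = x] = \bigcup_(n in N) P n.
    apply/seteqP; split=> y; first by move=> [n Pn rn]; exists n => //; split=> //; exists y.
    by move=> [n [_ rn] Pn]; exists n.
  rewrite /blow EZ; split.
    by apply: clopen_bigcup => // n _; have [] := RP n.
  have [[n0 Nn0]|N0] := pselect (N !=set0); last first.
    suff -> : N = set0 by rewrite bigcup_set0 setU0; exact: conn1.
    by rewrite -subset0 => n Nn; apply: N0; exists n.
  have -> : [set x] `|` \bigcup_(n in N) P n = \bigcup_(n in N) ([set x] `|` P n).
    apply/seteqP; split=> y; last first.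
      by move=> [n Nn [->|Pn]]; [left|right; exists n].
    by move=> [->|[n Nn Pn]]; [exists n0 => //; left|exists n => //; right].
  apply: (@conn_bigcup _ es _ _ _ x) => //; first by exists n0.
  move=> n [Pn0 rn]; split; last by left.
  have [_ _ _ /(_ Pn0)[cPn _]] := RP n; have [_ Pw xw] := rwP _ Pn0.
  apply: connU => //; first exact: conn1.
  by exists x, (rw n).2; split=> //; rewrite -rn.
- move=> y Dy nRy; have [n _ ny] := enD _ Dy.
  (* A vertex in no piece would survive until its own stage, where it must be covered. *)
  apply: contrapT => nZ.
  have nP m : ~ P m y by move=> Pm; apply: nZ; exists (rw m).1, m.
  have [+ _ _ _] := RP n; rewrite ny => hP; apply: (nP n); apply: hP => //.
  elim: n {ny} => [|n IH]; first by rewrite D0.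
  by rewrite DS; split.
Qed.

End Structure.

(** * Quotients and models *)

Section Quotient.
Variables (e : V -> V -> Prop) (es : symr e) (D R : set V) (Z : V -> set V).
Hypothesis yD : ystruct e D R Z.
Implicit Types A B O : set V.

Local Notation W := (blow Z).

Lemma ystruct_notin x : ~ D x -> W x = [set x].
Proof.
have [[RD _] h _ _ _] := yD => nDx.
by apply/seteqP; split=> y; [move=> [//|/h[/RD]]|left].
Qed.

Lemma blow_sub x : R x -> W x `<=` D.
Proof. by have [[RD _] h _ _ _] := yD => Rx y [->|/h[]//]; exact: RD. Qed.

Lemma blow_inj x y z : R x -> R y -> W x z -> W y z -> x = y.
Proof.
have [_ h inj _ _] := yD => Rx Ry [->|xz] [yz|yz] //.
- by have [] := h _ _ yz.
- by rewrite yz in xz; have [] := h _ _ xz.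
- exact: inj xz yz.
Qed.

(** Besides the edge [xy], every such edge lies in the boundary of [Z x] or of [Z y]. *)
Lemma finite_blow_cut x y : R x -> R y -> x <> y -> finite_set (cut e (W x) (W y)).
Proof.
have [[RD _] h inj cl _] := yD => Rx Ry xy.
apply: (@sub_finite_set _ _ (cut e (Z x) (D `\` Z x) `|`
   (cut e (D `\` Z y) (Z y) `|` [set (x, y)]))).
  move=> [a b] [/= Wa Wb ab]; have Db := blow_sub Ry Wb; have Da := blow_sub Rx Wa.
  case: Wa => [ax|Za]; last first.
    left; split=> //; split=> // Zb; apply: xy.
    by apply: (@blow_inj _ _ b) => //; right.
  right; case: Wb => [by_|Zb]; [right; by rewrite ax by_|left; split=> //].
  by split=> // Za; apply: xy; apply: (@blow_inj _ _ a) => //; [left|right].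
rewrite !finite_setU; split; first by have [[]] := cl _ Rx.
by split=> //; apply: finite_cut_sym => //; have [[]] := cl _ Ry.
Qed.

Lemma symr_quo : symr (quo e W).
Proof. by move=> x y; exact: touch_sym. Qed.

(** Each quotient edge stands for finitely many edges, so a finite cut of the quotient would lift to
    a clopen subset of [D] that separates two vertices of [R]. *)
Lemma icut_quo : icut (quo e W) R.
Proof.
have [[RD iR] h inj cl cov] := yD.
move=> A AR [a Aa] [b [Rb nAb]] fin.
pose A' : set V := \bigcup_(x in A) W x.
have cA' : clopen e D A'.
  split; first by move=> y [x /AR /blow_sub]; exact.
  apply: (@sub_finite_set _ _ (\bigcup_(z in cut (quo e W) A (R `\` A))
    cut e (W z.1) (W z.2))).
    move=> [c d] [/= [x Ax Wc] [Dd nA'd] cd].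
    have [y [Ry Wd]] : exists y, R y /\ W y d.
      have [Rd|/(cov _ Dd)[y Zy]] := pselect (R d); first by exists d; split=> //; left.
      by exists y; split; [have [] := h _ _ Zy|right].
    exists (x, y); last by [].
    split=> //=; first by split=> // Ay; apply: nA'd; exists y.
    by exists c, d.
  apply: bigcup_finite => // -[x y] [/= Ax [Ry nAy] _].
  by apply: finite_blow_cut => // [|xy]; [exact: AR|rewrite -xy in nAy].
have [] := iR A' a b cA' (AR _ Aa) Rb; first by exists a => //; left.
by move=> x Ax [bx|/h[]//]; rewrite bx in nAb.
Qed.

Lemma quo_top p x : tied e p D -> Z x !=set0 -> quo e W x p.
Proof.
have [_ h _ cl _] := yD => gD Z0.
have Rx : R x by case: Z0 => y /h[].
have [a [b [Za -> ab]]] := touch_cut (tied_touch gD (cl _ Rx).1 Z0).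
by exists a, p; split=> //; [right|left].
Qed.

(* Contracting pieces merges edges to [p], so this needs an argument: a piece
   absorbed by [x] makes [x] a neighbour of [p], hence only finitely many of the
   pieces matter, and each has a finite boundary. *)
Lemma tied_quo p O : ~ D p -> tied e p D -> tied e p (D `\` O) -> finite_set O ->
  O `<=` R -> tied (quo e W) p (R `\` O).
Proof.
have [[RD iR] h inj cl cov] := yD.
move=> nDp gD gDO fO OR A AR A0 fin.
have Ain : A `<=` D `\` O by move=> x /AR[/RD].
apply: (gDO A Ain A0).
set F := cut (quo e W) A _ in fin.
(* By [quo_top], [N] contains every vertex of [A] or [O] that has a nonempty piece. Any other piece
   belongs to a vertex outside [A] and [O], so an edge from [A] into it yields a quotient edge in
   [F]. *)
pose N := [set x | A x /\ quo e W x p] `|` O.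
have RN : N `<=` R by move=> x [[/AR[] ]|/OR].
have fN : finite_set N.
  rewrite finite_setU; split=> //.
  apply: (finite_set_inj (f := fun x => (x, p))) fin => [x [Ax xp]|x y _ _ []//].
  by split=> //=; right.
have nRp : ~ R p by move=> /RD.
apply: (@sub_finite_set _ _ (F `|` ((\bigcup_(x in N) cut e (D `\` Z x) (Z x)) `|`
  \bigcup_(z in F `&` [set z | R z.2]) cut e (W z.1) (W z.2)))).
  move=> [a b] [/= Aa H ab].
  have [Ra nOa] := AR _ Aa.
  have Qab : quo e W a b by exists a, b; split=> //; left.
  have [[[Db nOb] nAb]|bp] := H; last by left; split=> //=; right.
  have [Rb|nRb] := pselect (R b); first by left; split=> //=; left.
  have [x Zxb] := cov _ Db nRb; have [Rx _ _] := h _ _ Zxb.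
  right; have [Nx|nNx] := pselect (N x).
    left; exists x => //; split=> //=; split; first exact: RD.
    by move=> /h[].
  right; exists (a, x); last by split=> //=; [left|right].
  split=> //; split=> //=; last by exists a, b; split=> //; [left|right].
  left; split; first by split=> // Ox; apply: nNx; right.
  move=> Ax; apply: nNx; left; split=> //; apply: quo_top => //.
  by exists b.
rewrite !finite_setU; split=> //; split; apply: bigcup_finite => //.
- move=> x Nx; apply: finite_cut_sym => //.
  by have [[]] := cl _ (RN _ Nx).
- by apply: sub_finite_set fin => z [].
- move=> [x y] [[/= Ax xy _] Ry]; apply: finite_blow_cut => //; first by have [] := AR _ Ax.
  move=> E; move: xy => [[_]|yp]; first by rewrite -E.
  by apply: nRp; rewrite -yp.
Qed.

End Quotient.

(* The graph [(e', I')] is a minor of [(e, I)] with branch sets [B x]. *)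
Definition model (e : V -> V -> Prop) (I : set V) (e' : V -> V -> Prop) (I' : set V)
    (B : V -> set V) :=
  [/\ forall x, I' x -> conn e (B x) /\ B x `<=` I,
      forall x y z, I' x -> I' y -> B x z -> B y z -> x = y &
      forall x y, I' x -> I' y -> x <> y -> e' x y -> touch e (B x) (B y)].

Definition big (B : V -> set V) (A : set V) : set V :=
  [set y | exists2 x, A x & B x y].

Lemma bigS B A A' : A `<=` A' -> big B A `<=` big B A'.
Proof. by move=> AA y [x /AA Ax Bx]; exists x. Qed.

Section Model.
Variables (e : V -> V -> Prop) (I : set V) (e' : V -> V -> Prop) (I' : set V)
  (B : V -> set V).
Hypotheses (es : symr e) (mB : model e I e' I' B).
Implicit Types A : set V.

Lemma big_sub A : A `<=` I' -> big B A `<=` I.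
Proof. by have [h _ _] := mB => AI y [x /AI/h[_ BI] /BI]. Qed.

Lemma big_disj A A' : A `<=` I' -> A' `<=` I' -> disj A A' -> disj (big B A) (big B A').
Proof.
have [_ inj _] := mB => AI AI' dA z [x Ax Bx] [y Ay By].
by apply: (dA x) => //; rewrite (inj x y z) //; [exact: AI|exact: AI'].
Qed.

Lemma big_touch A A' : A `<=` I' -> A' `<=` I' -> disj A A' -> touch e' A A' ->
  touch e (big B A) (big B A').
Proof.
have [_ _ tB] := mB => AI AI' dA [x [y [Ax Ay xy]]].
have ne : x <> y by move=> E; rewrite E in Ax; exact: dA Ax Ay.
have [a [b [Ba Bb ab]]] := tB x y (AI _ Ax) (AI' _ Ay) ne xy.
by exists a, b; split=> //; [exists x|exists y].
Qed.

Lemma big_conn A : A `<=` I' -> conn e' A -> conn e (big B A).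
Proof.
have [h inj tB] := mB => AI [[x Ax] cA].
have [[[a Ba] _] _] := h _ (AI _ Ax).
apply: (@conn_intro _ es _ a); first by exists x.
move=> C Ca cl.
have sat y b : A y -> B y b -> C b -> B y `<=` C.
  move=> Ay Bb Cb; have [[_ cB] _] := h _ (AI _ Ay).
  apply: (cB C b) => // c d Bc Cc Bd cd; apply: (cl c d) => //; by exists y.
have hA : A `<=` [set y | B y `<=` C].
  apply: (cA _ x) => //; first exact: sat Ba Ca.
  move=> y z Ay BC Az yz.
  have [<-//|ne] := pselect (y = z).
  have [b [c [Bb Bc bc]]] := tB y z (AI _ Ay) (AI _ Az) ne yz.
  apply: (sat z c) => //; apply: (cl b c) => //; first by exists y.
    exact: BC.
  by exists z.
by move=> b [y /hA]; exact.
Qed.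

Lemma model_comp e'' I'' B' : symr e' -> model e' I' e'' I'' B' ->
  model e I e'' I'' (fun x => big B (B' x)).
Proof.
move=> es' [h' inj' t']; split.
- move=> x /h'[cB BI]; split; [exact: big_conn|exact: big_sub].
- move=> x y z Ix Iy [x' Bx xz] [y' By yz]; have [_ inj _] := mB.
  have E : x' = y' by apply: inj xz yz; [exact: (h' _ Ix).2|exact: (h' _ Iy).2].
  by apply: inj' Bx _ => //; rewrite E.
- move=> x y Ix Iy xy exy; apply: big_touch.
  + exact: (h' _ Ix).2.
  + exact: (h' _ Iy).2.
  + by move=> z Bx By; apply: xy; exact: inj' Bx By.
  + exact: t'.
Qed.

End Model.

Lemma ystruct_model e D R Z p : symr e -> ystruct e D R Z -> ~ D p ->
  model e (D `|` [set p]) (quo e (blow Z)) (R `|` [set p]) (blow Z).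
Proof.
move=> es yD nDp; have [[RD _] _ _ cl _] := yD; split.
- move=> x [Rx|->].
    by split; [have [] := cl _ Rx|move=> y /(blow_sub yD Rx); left].
  by rewrite (ystruct_notin yD nDp); split; [exact: conn1|right].
- move=> x y z [Rx|->] [Ry|->]; rewrite ?(ystruct_notin yD nDp) //.
  + exact: (blow_inj yD).
  + by move=> /(blow_sub yD Rx) Dz zp; rewrite zp in Dz.
  + by move=> -> /(blow_sub yD Ry).
- by [].
Qed.

(** * Minors by recursion *)

(* The set [t] is the branch set of the apex; the tree lives on finite sequences. *)
Definition T_minor (e : V -> V -> Prop) (I : set V) :=
  exists (K : seq nat -> set V) (t : set V),
  [/\ forall s, conn e (K s) /\ K s `<=` I,
      conn e t /\ t `<=` I,
      (forall s s', s <> s' -> disj (K s) (K s')) /\ (forall s, disj t (K s)),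
      forall s i, touch e (K s) (K (rcons s i)) &
      forall s, touch e (K s) t].

(* The children of the state [s] carry the subtrees at the neighbours of the
   branch set [K], and [P s] grows towards the branch set of the apex. *)
Lemma T_minor_rec e I (S : Type) (P reg rt : S -> set V) (s0 : S) : symr e ->
  (forall s, [/\ conn e (P s), P s `<=` I, reg s `<=` I & disj (P s) (reg s)]) ->
  (forall s, exists K (c : nat -> S),
    [/\ conn e K /\ K `<=` reg s,
        rt s `<=` K,
        forall i, [/\ P s `<=` P (c i), P (c i) `<=` P s `|` reg s,
                      reg (c i) `<=` reg s, disj K (reg (c i)) & disj K (P (c i))],
        forall i j, i <> j ->
          disj (reg (c i)) (reg (c j)) /\ disj (P (c i)) (reg (c j)) &
        (forall i, touch e K (rt (c i))) /\ exists i, touch e K (P (c i))]) ->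
  T_minor e I.
Proof.
move=> es val /choice[Kf /choice[c step]].
(* The head of the sequence is the first choice made, so statements about two sequences follow by
   induction for all starting states. *)
pose st := fix st s (l : seq nat) := if l is i :: l' then st (c s i) l' else s.
have regS s l : reg (st s l) `<=` reg s.
  elim: l s => [|i l IH] s //=; have [_ _ /(_ i)[_ _ h _ _] _ _] := step s.
  by move=> x /IH/h.
have PS s l : P s `<=` P (st s l).
  elim: l s => [|i l IH] s //=; have [_ _ /(_ i)[h _ _ _ _] _ _] := step s.
  by move=> x /h/IH.
have PU s l : P (st s l) `<=` P s `|` reg s.
  elim: l s => [|i l IH] s x /=; first by left.
  have [_ _ /(_ i)[_ h2 h3 _ _] _ _] := step s.
  by move=> /IH[/h2|/h3]; [|right].
have KS s l : Kf (st s l) `<=` reg s.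
  by have [[_ h] _ _ _ _] := step (st s l); move=> x /h/regS.
have dK s l l' : l <> l' -> disj (Kf (st s l)) (Kf (st s l')).
  have nilc i l0 s' : disj (Kf s') (Kf (st (c s' i) l0)).
    have [_ _ /(_ i)[_ _ _ h _] _ _] := step s'.
    by move=> x Kx /KS; exact: h Kx.
  elim: l l' s => [|i l IH] [|j l'] s /= ne.
  - by [].
  - exact: nilc.
  - by move=> x Kx Kx'; exact: nilc Kx' Kx.
  - have [E|ij] := pselect (i = j).
      by rewrite E; apply: IH => E'; apply: ne; rewrite E E'.
    have [_ _ _ /(_ i j ij)[h _] _] := step s.
    by move=> x /KS hi /KS; exact: h hi.
have dP s l l' : disj (P (st s l)) (Kf (st s l')).
  elim: l l' s => [|i l IH] [|j l'] s /=.
  - have [[_ h] _ _ _ _] := step s; have [_ _ _ d] := val s.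
    by move=> x Px /h; exact: d Px.
  - have [_ _ /(_ j)[h _ _ _ _] _ _] := step s.
    by have [_ _ _ d] := val (c s j); move=> x /h Px /KS; exact: d Px.
  - have [_ _ /(_ i)[_ _ _ h1 h2] _ _] := step s.
    by move=> x /PU[Px|rx] Kx; [exact: h2 Kx Px|exact: h1 Kx rx].
  - have [E|ij] := pselect (i = j); first by rewrite E; exact: IH.
    have [_ _ _ /(_ i j ij)[h1 h2] _] := step s.
    by move=> x /PU[Px|rx] /KS; [exact: h2 Px|exact: h1 rx].
(* Every state reached from [s0] has [P s0] inside its apex part, so the union of these parts is
   connected. *)
exists (fun l => Kf (st s0 l)), (\bigcup_l P (st s0 l)); split.
- move=> l; have [[cK KS'] _ _ _ _] := step (st s0 l); split=> // x /KS.
  by have [_ _ h _] := val s0; exact: h.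
- split; last by move=> x [l _]; have [_ h _ _] := val (st s0 l); exact: h.
  have [[[x Px] _] _ _ _] := val s0.
  apply: (@conn_bigcup _ es _ _ _ x); first by exists [::].
  by move=> l _; split; [have [] := val (st s0 l)|exact: PS].
- by split; [move=> l l'; exact: dK|move=> l x [l' _]; exact: dP].
- move=> l; elim: l s0 => [|i l IH] s j /=; last exact: IH.
  have [_ _ _ _ [/(_ j) h _]] := step s.
  by apply: touchS h => //; have [] := step (c s j).
- move=> l; have [_ _ _ _ [_ [i h]]] := step (st s0 l).
  apply: touchS h => // x Px; exists (rcons l i) => //.
  by elim: l s0 Px => [|j l IH] s //=; exact: IH.
Qed.

Lemma T_minor_model e I e' I' B : symr e -> model e I e' I' B -> T_minor e' I' -> T_minor e I.
Proof.
move=> es mB [K [t [cK [ct tI] [dK dt] tK tt]]].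
have KI s := (cK s).2.
exists (fun s => big B (K s)), (big B t); split.
- by move=> s; split; [apply: (big_conn es mB) => //; exact: (cK s).1|exact: (big_sub mB)].
- by split; [exact: (big_conn es mB)|exact: (big_sub mB)].
- by split=> [s s' ne|s]; apply: (big_disj mB) => //; exact: dK.
- move=> s i; apply: (big_touch mB) => //; apply: dK => /(congr1 size).
  by rewrite size_rcons => /n_Sn.
- by move=> s; apply: (big_touch mB) => // x Kx tx; exact: dt tx Kx.
Qed.

Lemma T_minorS e I I' : I' `<=` I -> T_minor e I' -> T_minor e I.
Proof.
move=> II [K [t [cK [ct tI] d tK tt]]]; exists K, t; split=> //.
- by move=> s; have [? KI] := cK s; split=> // x /KI/II.
- by split=> // x /tI/II.
Qed.

(** The set [E 0] is tied to [p], hence adjacent to it; adding it to [K] makes [K] adjacent to [p]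
    and leaves infinitely many sets. *)
Lemma nontight_touch e p D r : symr e -> nontight e p D r ->
  exists K (E : nat -> set V),
  [/\ conn e K /\ touch e K [set p], K r, K `<=` D,
      forall m n, m <> n -> disj (E m) (E n) &
      forall n, [/\ conn_tied e p (E n), E n `<=` D, disj K (E n) & touch e K (E n)]].
Proof.
move=> es [K [E [cK Kr KD dE hE]]].
exists (K `|` E 0), (fun n => E n.+1); have [[cE gE nEp] ED dKE tKE] := hE 0; split.
- split; first exact: connU.
  have [a [b [Ea -> ab]]] := touch_cut (tied_touch gE (clopenT e (E 0)) cE.1).
  by exists a, p; split=> //; right.
- by left.
- by move=> x [/KD|/ED].
- by move=> m n mn; apply: dE => -[].
- move=> n; have [gn En dn tn] := hE n.+1; split=> //.
  + by move=> x [/dn|E0x En']; [exact|exact: dE E0x En'].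
  + by apply: touchS tn => // x; left.
Qed.

(* If no vertex were tight, expanding forever would give the minor with [p] as
   apex. *)
Lemma exists_tight e p D I : symr e -> conn_tied e p D -> D `|` [set p] `<=` I ->
  ~ T_minor e I ->
  exists D' r, [/\ conn_tied e p D', D' `<=` D, D' r & ~ nontight e p D' r].
Proof.
move=> es gD DI nT; apply: contrapT => none; apply: nT; apply: (T_minorS DI).
pose S := {s : set V * V | [/\ conn_tied e p s.1, s.1 `<=` D & s.1 s.2]}.
have [[[r Dr] cD] _ _] := gD.
have s0 : S by exists (D, r); split.
apply: (@T_minor_rec _ _ S (fun=> [set p]) (fun s => (sval s).1)
  (fun s => [set (sval s).2]) s0) => //.
- move=> [[D' r'] [[_ _ nDp] /= DD D'r]]; split; first exact: conn1.
  + by move=> _ ->; right.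
  + by move=> x /DD; left.
  + by move=> _ ->.
- move=> [[D' r'] [gD' /= DD D'r]].
  have : nontight e p D' r' by apply: contrapT => nt; apply: none; exists D', r'.
  move=> /(nontight_touch es)[K [E [[cK tK] Kr KD dE hE]]].
  have /choice[rt rtP] n : exists x, E n x /\ touch e K [set x].
    have [_ _ _ [a [b [Ka Eb ab]]]] := hE n.
    by exists b; split=> //; exists a, b.
  have Pn n : [/\ conn_tied e p (E n, rt n).1, (E n, rt n).1 `<=` D &
      (E n, rt n).1 (E n, rt n).2].
    have [g ED _ _] := hE n; split=> //=; [by move=> x /ED/DD|exact: (rtP n).1].
  exists K, (fun n => exist _ (E n, rt n) (Pn n) : S); split=> //=.
  + by move=> _ ->.
  + move=> i; have [[_ _ nEp] ED dK _] := hE i; split; [by []|by move=> x; left|exact: ED|exact: dK|].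
    have [_ _ nDp] := gD'; move=> x Kx xp; apply: nDp.
    by rewrite -xp; exact: KD.
  + move=> i j ij; split; first exact: dE.
    by have [[_ _ nEp] _ _ _] := hE j => _ ->.
  + by split; [move=> i; exact: (rtP i).2|exists 0].
Qed.

Definition football_minor (e : V -> V -> Prop) (I : set V) (p r : V) :=
  exists e' I' B a b,
  [/\ symr e' /\ model e I e' I' B, a <> b /\ I' a /\ I' b, B a p /\ B b r,
      icut e' I' & icut e' (I' `\` [set a; b])].

Lemma football_minor_model e I e' I' B p r p' r' : symr e -> symr e' -> model e I e' I' B ->
  B p' p -> B r' r -> football_minor e' I' p' r' -> football_minor e I p r.
Proof.
move=> es es' mB Bp Br [e2 [I2 [B2 [a [b [[es2 m2] ab [Ba Bb] i1 i2]]]]]].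
exists e2, I2, (fun x => big B (B2 x)), a, b; split=> //.
- by split=> //; exact: (model_comp es mB es' m2).
- by split; [exists p'|exists r'].
Qed.

(* A minor with vertex set [st_dom] + [st_top] and branch sets [st_br]; the root
   is where the tree side is attached, and [st_top] belongs to the apex side. *)
Record state := State { st_rel : V -> V -> Prop; st_dom : set V; st_top : V; st_root : V;
  st_br : V -> set V }.

Definition valid (e : V -> V -> Prop) (I : set V) (s : state) :=
  [/\ symr (st_rel s), conn_tied (st_rel s) (st_top s) (st_dom s), st_dom s (st_root s),
      enumerable (st_dom s) & model e I (st_rel s) (st_dom s `|` [set st_top s]) (st_br s)].

(** One round of the recursion at the pair [(p, r)]: [K] is the branch set of a tree vertex and the
    states [c i] are its children. Their domains use disjoint vertex sets, whereas all tops contain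
    [p] and may overlap, since they end up in the one branch set of the apex. *)
Definition step (e : V -> V -> Prop) (I : set V) (p r : V) :=
  exists K (c : nat -> state),
  [/\ [/\ conn e K, K `<=` I & K r],
      forall i, valid e I (c i) /\ st_br (c i) (st_top (c i)) p,
      (forall i j x, st_dom (c j) x -> disj (st_br (c i) (st_top (c i))) (st_br (c j) x)) /\
      (forall i j x y, i <> j -> st_dom (c i) x -> st_dom (c j) y ->
         disj (st_br (c i) x) (st_br (c j) y)),
      forall i x, (st_dom (c i) `|` [set st_top (c i)]) x -> disj K (st_br (c i) x) &
      (forall i, touch e K (st_br (c i) (st_root (c i)))) /\
      exists i, touch e K (st_br (c i) (st_top (c i)))].

Lemma step_model e I e' I' B p r p' r' : symr e -> symr e' -> model e I e' I' B ->
  B p' p -> B r' r -> step e' I' p' r' -> step e I p r.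
Proof.
move=> es es' mB Bp Br [K [c [[cK KI Kr] vc [d1 d2] dK [tK1 tK2]]]].
have brI i x : (st_dom (c i) `|` [set st_top (c i)]) x -> st_br (c i) x `<=` I'.
  by move=> cx; have [[_ _ _ _ [h _ _]] _] := vc i; have [] := h _ cx.
have tI i : st_br (c i) (st_top (c i)) `<=` I' by apply: brI; right.
have rI i : st_br (c i) (st_root (c i)) `<=` I'.
  by apply: brI; left; have [[]] := vc i.
exists (big B K), (fun i => State (st_rel (c i)) (st_dom (c i)) (st_top (c i)) (st_root (c i))
  (fun x => big B (st_br (c i) x))); split=> /=.
- by split; [exact: (big_conn es mB)|exact: (big_sub mB)|exists r'].
- move=> i; have [[v1 v2 v3 v4 v5] hp] := vc i; split; last by exists p'.
  by split=> //=; exact: (model_comp es mB es' v5).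
- split=> [i j x cx|i j x y ij cx cy]; apply: (big_disj mB) => //.
  + by apply: brI; left.
  + exact: d1.
  + by apply: brI; left.
  + by apply: brI; left.
  + exact: d2.
- by move=> i x cx; apply: (big_disj mB) => //; [exact: brI cx|exact: dK].
- split=> [i|].
    apply: (big_touch mB) => //; apply: dK; left; by have [[]] := vc i.
  have [i ti] := tK2; exists i; apply: (big_touch mB) => //.
  by apply: dK; right.
Qed.

(** * Football or expansion *)

Lemma enumerableS (A B : set V) : A `<=` B -> enumerable B -> enumerable A.
Proof. by move=> AB [f fB]; exists f => x /AB/fB. Qed.

Lemma modelS e I1 I e' I' B : I1 `<=` I -> model e I1 e' I' B -> model e I e' I' B.
Proof. by move=> II [h inj t]; split=> // x /h[cB BI]; split=> // y /BI/II. Qed.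

Lemma model1 e (I I' : set V) : symr e -> I' `<=` I -> model e I e I' (fun x => [set x]).
Proof.
move=> es II; split.
- by move=> x Ix; split; [exact: conn1|move=> _ ->; exact: II].
- by move=> x y z _ _ -> ->.
- by move=> x y _ _ _ xy; exists x, y.
Qed.

(** [L] is extended inside [E \ S] as far as possible; since [L + E] is connected, the extension
    stops only next to [S]. *)
Lemma link e L E S : symr e -> conn e L -> conn e E -> touch e L E ->
  S `<=` E -> S !=set0 -> disj L E ->
  exists L', [/\ conn e L', L `<=` L', L' `<=` L `|` (E `\` S) & touch e L' S].
Proof.
move=> es cL cE tLE SE [s Ss] dLE; have [[l Ll] _] := cL.
pose L' := compon e (L `|` (E `\` S)) l.
have Ul : (L `|` (E `\` S)) l by left.
have LL' : L `<=` L'.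
  by apply: (compon_max es (y := l)); [|by move=> x; left| |exact: compon_refl].
have cLE : conn e (L `|` E) by exact: connU.
exists L'; split; [exact: conn_compon|by []|exact: compon_sub|].
have nL's : ~ L' s by move=> /compon_sub[Ls|[]//]; exact: dLE Ls (SE _ Ss).
have [||a [b [[_ L'a] [LEb nL'b] ab]]] := conn_touch (B := L') cLE.
- by exists l; split; [exact: LL'|left].
- by exists s; split=> //; right; exact: SE.
exists a, b; split=> //; apply: contrapT => nSb; apply: nL'b.
apply: (compon_closed es L'a _ ab).
by case: LEb => [Lb|Eb]; [left|right].
Qed.

Lemma tight_ystruct e p D r : symr e -> conn_tied e p D -> enumerable D -> D r ->
  ~ nontight e p D r -> exists Z, ystruct e D (insep_class e D r) Z.
Proof.
move=> es [cD gD nDp] nD Dr nt; apply: piece_assign => // x Rx.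
exact: (tight_finite es cD gD nDp Dr nt).
Qed.

Lemma step_nontight e p D r : symr e -> conn_tied e p D -> enumerable D ->
  nontight e p D r -> step e (D `|` [set p]) p r.
Proof.
move=> es [_ _ nDp] nD /(nontight_touch es)[K [E [[cK tK] Kr KD dE hE]]].
have /choice[rt rtP] n : exists x, E n x /\ touch e K [set x].
  have [_ _ _ [a [b [Ka Eb ab]]]] := hE n.
  by exists b; split=> //; exists a, b.
exists K, (fun n => State e (E n) p (rt n) (fun x => [set x])); split=> /=.
- by split=> // x /KD; left.
- move=> i; have [gE ED _ _] := hE i; split=> //; split=> //=.
  + exact: (rtP i).1.
  + exact: enumerableS ED nD.
  + by apply: model1 => // x [/ED|->]; [left|right].
- split=> [i j x Ex _ -> px|i j x y ij Ex Ey _ -> xy].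
    by have [_ ED _ _] := hE j; apply: nDp; rewrite px; exact: ED.
  by rewrite xy in Ex; exact: dE ij _ Ex Ey.
- move=> i x [Ex|->] y Ky yx; last by apply: nDp; rewrite -yx; exact: KD.
  by have [_ _ dK _] := hE i; rewrite yx in Ky; exact: dK Ky Ex.
- by split; [move=> i; exact: (rtP i).2|exists 0].
Qed.

(** Here [r] is the apex in [exists_tight], which yields a tight vertex in a subset of [E] and thus
    an infinitely edge-connected quotient on [R]. An extension of [L] reaches the branch set of some
    [p1] in [R] and joins it, and [p1] becomes the top. The root is another vertex of [R] adjacent
    to [r] in the quotient. *)
Lemma step_child e I L E r : symr e -> enumerable I -> conn e L -> L `<=` I -> I r ->
  conn_tied e r E -> E `<=` I -> disj L E -> touch e L E -> ~ T_minor e I ->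
  exists s, [/\ valid e I s, L `<=` st_br s (st_top s), st_br s (st_top s) `<=` L `|` E,
    forall x, st_dom s x -> st_br s x `<=` E & touch e [set r] (st_br s (st_root s))].
Proof.
move=> es cI cL LI Ir gE EI dLE tLE nT.
have EI' : E `|` [set r] `<=` I by move=> x [/EI|->].
have [D [s [gD DE Ds nt]]] := exists_tight es gE EI' nT.
have nD : enumerable D by apply: enumerableS cI => x /DE/EI.
have [Z yD] := tight_ystruct es gD nD Ds nt.
set R := insep_class e D s in yD; set W := blow Z; pose e1 := quo e W.
have es1 : symr e1 by exact: symr_quo.
have RD : R `<=` D by exact: insep_class_sub.
have [cD gcD nDr] := gD; have [cE _ _] := gE.
have D0 : D !=set0 by exists s.
have [L' [cL' LL' L'LE [a [d [L'a Dd ad]]]]] := link es cL cE tLE DE D0 dLE.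
have [p1 [Rp1 Wd]] : exists x, R x /\ W x d.
  have [Rd|nRd] := pselect (R d); first by exists d; split=> //; left.
  have [_ h _ _ cov] := yD; have [x Zx] := cov _ Dd nRd.
  by exists x; split; [have [] := h _ _ Zx|right].
(* [R] is itself tied to [r] in the quotient, so [r] has neighbours besides [p1]. *)
have inf : infinite_set (cut e1 R [set r]).
  have := @tied_quo e es D R Z yD r set0 nDr gcD.
  rewrite !setD0 => /(_ gcD (finite_set0 _) (@sub0set _ _)).
  move=> /(_ R (@subset_refl _ R)); rewrite setDv set0U; apply.
  by exists p1.
have [y [Ry yp1 yr]] : exists y, [/\ R y, y <> p1 & e1 y r].
  apply: contrapT => none; apply: inf; apply: (@sub_finite_set _ _ [set (p1, r)]) => //.
  move=> [y r'] [/= Ry -> yr]; apply: contrapT => ne; apply: none; exists y; split=> //.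
  by move=> E'; apply: ne; rewrite E'.
pose D1 := compon e1 (R `\` [set p1]) y.
have D1R : D1 `<=` R by move=> x /compon_sub[].
have D1p1 : ~ D1 p1 by move=> /compon_sub[_]; apply.
have Ry1 : (R `\` [set p1]) y by [].
have WD x : R x -> W x `<=` D by exact: (blow_sub yD).
have L'D x : L' x -> ~ D x by move=> /L'LE[Lx /DE|[]//]; exact: dLE.
pose br x := W x `|` [set z | x = p1 /\ L' z].
have brE x : x <> p1 -> br x = W x.
  by move=> ne; apply/seteqP; split=> z; [move=> [//|[]]|left].
have brD x : R x -> x <> p1 -> br x `<=` D by move=> Rx /brE->; exact: WD.
have brp1 : br p1 = W p1 `|` L'.
  by apply/seteqP; split=> z [?|h]; [left|right; case: h|left|right].
have cW x : R x -> conn e (W x) by move=> Rx; have [_ _ _ cl _] := yD; have [] := cl _ Rx.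
have UR : D1 `|` [set p1] `<=` R by move=> x [/D1R|->].
exists (State e1 D1 p1 y br); split=> /=.
- split=> //=.
  + split=> //; first exact: conn_compon.
    move=> A AD A0; apply: sub_infinite_set (icut_quo es yD _ A0 _).
    * move=> [b c] [/= Ab [Rc nAc] bc]; split=> //=.
      have [->|cp1] := pselect (c = p1); first by right.
      left; split=> //; apply: (compon_closed es1 (AD _ Ab)) => //; by split.
    * by move=> x /AD/D1R.
    * by exists p1; split=> // /AD.
  + exact: compon_refl.
  + by apply: enumerableS nD => x /D1R/RD.
  + split.
    * move=> x /UR Rx; have [->|xp] := pselect (x = p1).
        rewrite brp1; split; last by move=> z [/(WD _ Rp1)/DE/EI|/L'LE[/LI|[/EI]]].
        by apply: connU => //; [exact: cW|exists d, a; split=> //; exact: es].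
      by rewrite brE //; split; [exact: cW|move=> z /(WD _ Rx)/DE/EI].
    * have aux x z : R x -> x <> p1 -> br p1 z -> br x z -> False.
        move=> Rx xp1; rewrite brp1 brE // => -[Wz Wz'|L'z /(WD _ Rx)].
          by apply: xp1; exact: (blow_inj yD) Wz' Wz.
        exact: L'D.
      move=> x x' z /UR Rx /UR Rx' bx bx'.
      have [E1|n1] := pselect (x = p1); have [E2|n2] := pselect (x' = p1).
      - by rewrite E1 E2.
      - by rewrite E1 in bx; have := aux _ _ Rx' n2 bx bx'.
      - by rewrite E2 in bx'; have := aux _ _ Rx n1 bx' bx.
      - by rewrite brE // in bx; rewrite brE // in bx'; exact: (blow_inj yD) bx bx'.
    * move=> x x' _ _ _ xx'; apply: touchS xx' => z; by left.
- by rewrite brp1 => z /LL'; right.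
- by rewrite brp1 => z [/(WD _ Rp1)/DE|/L'LE[|[]]]; [right|left|right].
- move=> x D1x z; rewrite brE; first by move=> /(WD _ (D1R _ D1x))/DE.
  by move=> xp; rewrite xp in D1x.
- rewrite brE //; apply: (touch_sym es); apply: touchS yr => // z.
  by rewrite /W (ystruct_notin yD nDr).
Qed.

(* The tree side starts at [r]; the first of the sets [E n] links it to the
   apex side [L], the others carry its children. *)
Lemma step_spread e I p r L (E : nat -> set V) : symr e -> enumerable I -> I r ->
  conn e L -> L `<=` I -> L p -> ~ L r ->
  (forall m n, m <> n -> disj (E m) (E n)) ->
  (forall n, [/\ conn_tied e r (E n), E n `<=` I, disj L (E n) & touch e L (E n)]) ->
  ~ T_minor e I -> step e I p r.
Proof.
move=> es cI Ir cL LI Lp nLr dE hE nT.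
have /choice[c cP] n : exists s, [/\ valid e I s, L `<=` st_br s (st_top s),
    st_br s (st_top s) `<=` L `|` E n, forall x, st_dom s x -> st_br s x `<=` E n &
    touch e [set r] (st_br s (st_root s))].
  by have [g EI d t] := hE n; exact: step_child.
have dLn i j x : st_dom (c i) x -> disj (st_br (c j) (st_top (c j))) (st_br (c i) x).
  move=> cx; have [vi _ _ /(_ _ cx) brE _] := cP i.
  have [_ _ topE _ _] := cP j.
  have [E'|ij] := pselect (j = i).
    rewrite E' => z h1 h2; have [_ [_ _ nt] _ _ [_ inj _]] := vi.
    apply: nt; rewrite (inj (st_top (c i)) x z) //; [by right|by left].
  move=> z /topE[Lz|Ez] /brE Ez'; last exact: dE ij _ Ez Ez'.
  by have [_ _ d _] := hE i; exact: d Lz Ez'.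
have [[cE0 gE0 nE0r] E0I d0 t0] := hE 0.
have tr0 : touch e [set r] (E 0).
  apply: (touch_sym es); apply: touch_cut.
  exact: tied_touch gE0 (clopenT _ _) cE0.1.
exists ([set r] `|` E 0), (fun n => c n.+1); split.
- split; last by left.
    by apply: connU => //; exact: conn1.
  by move=> x [->|/E0I].
- by move=> i; have [v LL _ _ _] := cP i.+1; split=> //; exact: LL.
- split=> [i j x cx|i j x y ij cx cy z]; first exact: dLn.
  have [_ _ _ /(_ _ cx) h _] := cP i.+1; have [_ _ _ /(_ _ cy) h' _] := cP j.+1.
  by move=> /h Ez /h'; apply: dE Ez => -[].
- move=> i x cx z Kz bz.
  have [_ _ topE brE _] := cP i.+1.
  have LEz : (L `|` E i.+1) z.
    by case: cx => [cx|E']; [right; exact: brE cx _ bz|rewrite E' in bz; exact: topE].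
  case: Kz => [zr|Ez].
    by rewrite zr in LEz; case: LEz => //; have [[]] := hE i.+1.
  by case: LEz => [Lz|Ez']; [exact: d0 Lz Ez|exact: dE Ez Ez'].
- split=> [i|].
    have [_ _ _ _ t] := cP i.+1; apply: touchS t => // z; by left.
  exists 0; have [_ LL _ _ _] := cP 1; apply: (touch_sym es).
  by apply: touchS t0 => // z; right.
Qed.

(** A clopen [Q] without a proper nonempty clopen part is infinitely edge-connected, and each of [p]
    and [r] sends infinitely many edges to it. *)
Lemma football_atom e I p r S Q : symr e -> I p -> I r -> S `<=` I -> p <> r ->
  ~ S p -> ~ S r -> tied e p S -> tied e r S -> clopen e S Q -> Q !=set0 ->
  (forall A, A `<=` Q -> A !=set0 -> Q `\` A !=set0 -> ~ clopen e S A) ->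
  football_minor e I p r.
Proof.
move=> es Ip Ir SI pr nSp nSr gp gr cQ Q0 atom.
have QS := cQ.1.
have iQ : icut e Q.
  move=> A AQ A0 QA0 fin; apply: (atom A) => //; apply: clopen_trans cQ _.
  by split.
have infQ y : [set p; r] y -> infinite_set (cut e Q [set y]).
  by move=> [->|->]; [exact: tied_touch gp cQ Q0|exact: tied_touch gr cQ Q0].
exists e, (Q `|` [set p; r]), (fun x => [set x]), p, r; split=> //.
- split=> //; apply: model1 => // x [/QS/SI|[->|->]] //.
- by split=> //; split; right; [left|right].
(* Three cases: [A] contains [Q], splits [Q] properly, or misses [Q] and so contains an end. *)
- move=> A AI A0 [z [Iz nAz]].
  have [QA|nQA] := pselect (Q `<=` A).
    have zpr : [set p; r] z by case: Iz => // /QA.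
    apply: sub_infinite_set (infQ z zpr); apply: cutS => // _ ->.
    by split.
  have [[x [Ax Qx]]|nAQ] := pselect (A `&` Q !=set0).
    apply: sub_infinite_set (iQ (A `&` Q) _ _ _).
    + apply: cutS => [y []//|y [Qy nAy]]; split; first by left.
      by move=> Ay; apply: nAy.
    + by move=> y [].
    + by exists x.
    + apply: contrapT => n; apply: nQA => y Qy; apply: contrapT => nAy; apply: n.
      by exists y; split=> // -[].
  have [x Ax] := A0.
  have xpr : [set p; r] x by case: (AI _ Ax) => // Qx; case: nAQ; exists x.
  move=> fin; apply: (infQ x xpr); apply: finite_cut_sym => //.
  apply: sub_finite_set fin; apply: cutS => [_ -> //|y Qy].
  by split; [left|move=> Ay; apply: nAQ; exists y].
- suff -> : (Q `|` [set p; r]) `\` [set p; r] = Q by [].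
  apply/seteqP; split=> x; first by move=> [[]].
  move=> Qx; split; [left|move=> [E|E]; rewrite E in Qx] => //.
    exact: nSp (QS _ Qx).
  exact: nSr (QS _ Qx).
Qed.

(** Without an atom as in [football_atom], every nonempty clopen set can be split again, so
    infinitely many disjoint connected clopen sets can be removed from [S]. Each is tied to [r] and
    adjacent to [p]. *)
Lemma football_or_step_tied e I p r S : symr e -> enumerable I -> I p -> I r ->
  S `<=` I -> p <> r ->
  ~ S p -> ~ S r -> tied e p S -> tied e r S -> S !=set0 -> ~ T_minor e I ->
  football_minor e I p r \/ step e I p r.
Proof.
move=> es cI Ip Ir SI pr nSp nSr gp gr S0 nT.
have [[Q [cQ Q0 atom]]|noatom] := pselect (exists Q, [/\ clopen e S Q, Q !=set0 &
    forall A, A `<=` Q -> A !=set0 -> Q `\` A !=set0 -> ~ clopen e S A]).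
  by left; exact: football_atom cQ Q0 atom.
right.
pose Inv Q := clopen e S Q /\ Q !=set0.
pose Rl (_ : nat) (_ Q : set V) := clopen e S Q /\ conn e Q.
have I0 : Inv S by split=> //; exact: clopenT.
have [n D [cD D0]|Ds [Q [_ DS _ QD RQ]]] := @peel Inv Rl _ I0.
  have [A [AD [x Ax] [y [Dy nAy]] cA]] : exists A, [/\ A `<=` D, A !=set0,
      D `\` A !=set0 & clopen e S A].
    apply: contrapT => n'; apply: noatom; exists D; split=> // A AD A0 DA0 cA.
    by apply: n'; exists A.
  have cQ : clopen e S (compon e A x) by exact: clopen_compon.
  exists (compon e A x); split.
  - by move=> z /compon_sub/AD.
  - by split=> //; exact: conn_compon.
  - split; first exact: clopenD.
    by exists y; split=> // /compon_sub.
have dQ := peel_disj DS QD.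
apply: (@step_spread e I p r [set p] Q) => //.
- exact: conn1.
- by move=> _ ->.
- by move=> rp; apply: pr.
- move=> n; have [cQ ccQ] := RQ n; have [QS _] := cQ; split.
  + by split=> //; [exact: tied_clopen gr cQ|move=> /QS].
  + by move=> x /QS/SI.
  + by move=> x -> /QS.
  + by apply: (touch_sym es); apply: touch_cut; exact: tied_touch gp cQ ccQ.1.
Qed.

(** A nonempty subset of [Y] has an infinite boundary, by [icut] or, for [{p}] alone, by the
    infinitely many neighbours of [p]; this boundary stays in [Y + r]. So [Y] is tied to [r], and
    tightness can be examined for [p] in [Y]. *)
Lemma football_or_step_icut e p r M : symr e -> enumerable M -> ~ M p -> M r -> icut e M ->
  infinite_set (cut e M [set p]) -> ~ T_minor e (M `|` [set p]) ->
  football_minor e (M `|` [set p]) p r \/ step e (M `|` [set p]) p r.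
Proof.
move=> es cM nMp Mr iM infp nT; set I := M `|` [set p].
have pr : p <> r by move=> E; rewrite E in nMp.
have cI : enumerable I.
  have [f fM] := cM; exists (fun n => if n is n'.+1 then f n' else p).
  by move=> x [/fM[n _ <-]|->]; [exists n.+1|exists 0].
have Ip : I p by right.
have Ir : I r by left.
pose Y := compon e (I `\` [set r]) p.
have Irp : (I `\` [set r]) p by split.
have Yp : Y p by exact: compon_refl.
have cY : conn e Y by exact: conn_compon.
have YI x : Y x -> I x /\ x <> r by move=> /compon_sub[].
have YM x : Y x -> x <> p -> M x by move=> /YI[[]].
have Ycl a b : Y a -> e a b -> I b -> b <> r -> Y b.
  by move=> Ya ab Ib br; apply: (compon_closed es Ya).
have gM A : A `<=` M -> A !=set0 -> ~ A r -> infinite_set (cut e A (M `\` A)).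
  by move=> AM A0 nAr; apply: iM => //; exists r.
have gYp : tied e r (Y `\` [set p]).
  move=> A AY A0; apply: sub_infinite_set (gM A _ A0 _).
  - move=> [a b] [/= Aa [Mb nAb] ab]; split=> //=.
    have [->|br] := pselect (b = r); first by right.
    left; split=> //; split; last by move=> bp; rewrite bp in Mb.
    by apply: (Ycl a) => //; [exact: (AY _ Aa).1|left].
  - by move=> x /AY[/YM].
  - by move=> /AY[/YI[]].
have gY : tied e r Y.
  move=> A AY A0.
  have [[x [Ax xp]]|n] := pselect (exists x, A x /\ x <> p).
    apply: sub_infinite_set (gM (A `&` M) _ _ _).
    - move=> [a b] [/= [Aa Ma] [Mb nAb] ab]; split=> //=.
      have [->|br] := pselect (b = r); first by right.
      left; split=> [|Ab]; last by apply: nAb.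
      by apply: (Ycl a) => //; [exact: AY|left].
    - by move=> y [].
    - by exists x; split=> //; apply: YM => //; exact: AY.
    - by move=> [/AY/YI[]].
  have Ep x : A x -> x = p.
    by move=> Ax; apply: contrapT => xp; apply: n; exists x.
  have Ap : A p by have [x Ax] := A0; rewrite -(Ep _ Ax).
  move=> fin; apply: infp; apply: finite_cut_sym => //.
  apply: sub_finite_set fin => -[a b] [/= -> Mb pb]; split=> //=.
  have [->|br] := pselect (b = r); first by right.
  left; split; first by apply: (Ycl p) => //; left.
  by move=> /Ep E; rewrite E in Mb.
have nYr : ~ Y r by move=> /YI[].
have goodY : conn_tied e r Y by [].
have cntY : enumerable Y by apply: enumerableS cI => x /YI[].
have [[L [E [cL Lp LY dE hE]]]|tight] := pselect (nontight e r Y p).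
  right; apply: (@step_spread e I p r L E) => //.
  - by move=> x /LY/YI[].
  - by move=> /LY.
  - by move=> n; have [? EY ? ?] := hE n; split=> // x /EY/YI[].
have [Z yY] := tight_ystruct es goodY cntY Yp tight.
set R := insep_class e Y p in yY; pose e2 := quo e (blow Z).
have es2 : symr e2 by exact: symr_quo.
have RY : R `<=` Y by exact: insep_class_sub.
have Rp : R p by exact: insep_class_refl.
have YrI : Y `|` [set r] `<=` I by move=> x [/YI[]|->].
have m2 := modelS YrI (ystruct_model es yY nYr).
have iR : icut e2 R := icut_quo es yY.
have nRr : ~ R r by move=> /RY.
have nT2 : ~ T_minor e2 (R `|` [set r]) by move=> h; apply: nT; exact: T_minor_model m2 h.
(* [tied_quo] is used with [O = {p}]: when [p] is dropped, the rest stays tied to [r]. *)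
have gS : tied e2 r (R `\` [set p]).
  by apply: (tied_quo es yY) => // _ ->.
have gp : tied e2 p (R `\` [set p]).
  move=> A AR A0; apply: sub_infinite_set (iR A _ A0 _).
  - move=> [a b] [/= Aa [Rb nAb] ab]; split=> //=.
    by have [->|bp] := pselect (b = p); [right|left].
  - by move=> x /AR[].
  - by exists p; split=> // /AR[_]; apply.
(* If [R] were [{p}], the only edge from [R] to [r] would be [(p, r)], although [R] is tied to
   [r]. *)
have S0 : R `\` [set p] !=set0.
  apply: contrapT => n.
  have Ep x : R x -> x = p.
    by move=> Rx; apply: contrapT => xp; apply: n; exists x.
  have := @tied_quo e es Y R Z yY r set0 nYr gY.
  rewrite !setD0 => /(_ gY (finite_set0 _) (@sub0set _ _)).
  move=> /(_ R (@subset_refl _ R)); rewrite setDv set0U; apply; first by exists p.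
  apply: (@sub_finite_set _ _ [set (p, r)]) => // -[a b] [/= /Ep-> -> _] //.
have cI2 : enumerable (R `|` [set r]) by apply: enumerableS cI => x [/RY/YI[]|->].
have Bp : blow Z p p by left.
have Br : blow Z r r by left.
have [|||||h|h] := @football_or_step_tied e2 (R `|` [set r]) p r (R `\` [set p])
    es2 cI2 _ _ _ pr _ _ gp gS S0 nT2.
- by left.
- by right.
- by move=> x []; left.
- by case=> _; apply.
- by case.
- by left; exact: football_minor_model m2 Bp Br h.
- by right; exact: step_model m2 Bp Br h.
Qed.

Lemma football_or_step e p D r : symr e -> conn_tied e p D -> enumerable D -> D r ->
  ~ T_minor e (D `|` [set p]) ->
  football_minor e (D `|` [set p]) p r \/ step e (D `|` [set p]) p r.
Proof.
move=> es gD cD Dr nT.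
have [nt|nt] := pselect (nontight e p D r).
  by right; exact: step_nontight.
have [cnD gcD nDp] := gD.
have [Z yD] := tight_ystruct es gD cD Dr nt.
set R := insep_class e D r in yD; pose e1 := quo e (blow Z).
have RD : R `<=` D by exact: insep_class_sub.
have es1 : symr e1 by exact: symr_quo.
have m1 := ystruct_model es yD nDp.
have inf : infinite_set (cut e1 R [set p]).
  have := @tied_quo e es D R Z yD p set0 nDp gcD.
  rewrite !setD0 => /(_ gcD (finite_set0 _) (@sub0set _ _)).
  move=> /(_ R (@subset_refl _ R)); rewrite setDv set0U; apply.
  by exists r; exact: insep_class_refl.
have Bp : blow Z p p by left.
have Br : blow Z r r by left.
have [|||||h|h] := @football_or_step_icut e1 p r R es1 _ _ _ _ inf.
- exact: enumerableS RD cD.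
- by move=> /RD.
- exact: insep_class_refl.
- exact: (icut_quo es yD).
- by move=> h; apply: nT; exact: T_minor_model m1 h.
- by left; exact: football_minor_model m1 Bp Br h.
- by right; exact: step_model m1 Bp Br h.
Qed.

(** * Links from the second end to the states *)

Lemma model_extend e I e' I' B b J : symr e -> model e I e' I' B -> I' b ->
  conn e J -> J `<=` I -> (forall x, I' x -> disj J (B x)) -> touch e J (B b) ->
  model e I e' I' (fun x => B x `|` [set y | x = b /\ J y]).
Proof.
move=> es [h inj t] Ib cJ JI dJ tJ; split.
- move=> x Ix; have [cB BI] := h _ Ix.
  have [->|xb] := pselect (x = b).
    have -> : [set y | b = b /\ J y] = J by apply/seteqP; split=> y // -[].
    split; last by move=> y [/(h _ Ib).2|/JI].
    by apply: connU => //; [exact: (h _ Ib).1|exact: touch_sym].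
  suff -> : B x `|` [set y | x = b /\ J y] = B x by [].
  by apply/seteqP; split=> y; [move=> [|[]]|left].
- move=> x y z Ix Iy [Bx|[xb Jz]] [By|[yb Jz']].
  + exact: inj Bx By.
  + by have := dJ _ Ix _ Jz' Bx.
  + by have := dJ _ Iy _ Jz By.
  + by rewrite xb yb.
- by move=> x y Ix Iy xy /(t _ _ Ix Iy xy); apply: touchS => z; left.
Qed.

(* A state carries, besides its model, a connected set [J] that links [q] to the
   root of the state outside the model. *)
Definition linked (e : V -> V -> Prop) (I : set V) (p q : V) (s : state) :=
  [/\ valid e I s, st_br s (st_top s) p &
      exists J, [/\ conn e J /\ J q, J `<=` I,
        forall x, (st_dom s `|` [set st_top s]) x -> disj J (st_br s x) &
        touch e J (st_br s (st_root s))]].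

(** The link [J] is added to the branch set of the end that contains the root, so that this branch
    set reaches [q]. *)
Lemma football_linked e I p q s : symr e -> linked e I p q s ->
  football_minor (st_rel s) (st_dom s `|` [set st_top s]) (st_top s) (st_root s) ->
  football_minor e I p q.
Proof.
move=> es [[es' _ _ _ mB] Bp [J [[cJ Jq] JI dJ tJ]]].
move=> [e2 [I2 [B2 [a [b [[es2 m2] [ab [Ia Ib]] [Ba Bb] i1 i2]]]]]].
have m := model_comp es mB es' m2.
have JB x : I2 x -> disj J (big (st_br s) (B2 x)).
  move=> Ix z Jz [y By Bz]; apply: (dJ y) Jz Bz.
  by have [h _ _] := m2; have [_] := h _ Ix; exact.
exists e2, I2, (fun x => big (st_br s) (B2 x) `|` [set y | x = b /\ J y]), a, b; split=> //.
- split=> //; apply: model_extend => //.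
  by apply: touchS tJ => // z Bz; exists (st_root s).
- by split; [left; exists (st_top s)|right].
Qed.

Lemma linked_step e I p q s : symr e -> linked e I p q s ->
  step (st_rel s) (st_dom s `|` [set st_top s]) (st_top s) (st_root s) ->
  exists K (c : nat -> state), (forall i, linked e I p q (c i)) /\
    [/\ conn e K /\ K `<=` big (st_br s) (st_dom s),
        st_br s (st_root s) `<=` K,
        forall i, [/\ st_br s (st_top s) `<=` st_br (c i) (st_top (c i)),
            st_br (c i) (st_top (c i)) `<=` st_br s (st_top s) `|` big (st_br s) (st_dom s),
            big (st_br (c i)) (st_dom (c i)) `<=` big (st_br s) (st_dom s),
            disj K (big (st_br (c i)) (st_dom (c i))) &
            disj K (st_br (c i) (st_top (c i)))],
        forall i j, i <> j ->
          disj (big (st_br (c i)) (st_dom (c i))) (big (st_br (c j)) (st_dom (c j))) /\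
          disj (st_br (c i) (st_top (c i))) (big (st_br (c j)) (st_dom (c j))) &
        (forall i, touch e K (st_br (c i) (st_root (c i)))) /\
        exists i, touch e K (st_br (c i) (st_top (c i)))].
Proof.
move=> es [[es' [_ _ nDp] Dr _ mB] Bp [J [[cJ Jq] JI dJ tJ]]].
set I' := st_dom s `|` [set st_top s] in mB dJ *; set B := st_br s in mB Bp dJ tJ *.
move=> [K [c [[cK KI Kr] vc [d1 d2] dK [tK1 tK2]]]].
have brI i x : (st_dom (c i) `|` [set st_top (c i)]) x -> st_br (c i) x `<=` I'.
  by move=> cx; have [[_ _ _ _ [h _ _]] _] := vc i; have [] := h _ cx.
have tI i : st_br (c i) (st_top (c i)) `<=` I' by apply: brI; right.
have rI i : st_br (c i) (st_root (c i)) `<=` I'.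
  by apply: brI; left; have [[]] := vc i.
have dI i x : st_dom (c i) x -> st_br (c i) x `<=` I' by move=> cx; apply: brI; left.
have ndtop i x : st_dom (c i) x -> ~ st_br (c i) x (st_top s).
  by move=> cx; apply: (d1 i i x cx); have [_ h] := vc i.
(* The top of each child contains the old top, and [K] avoids it, so [K] stays inside the domain. *)
have Kdom : K `<=` st_dom s.
  move=> x Kx; case: (KI _ Kx) => // E; have [_ h] := vc 0.
  by have := dK 0 (st_top (c 0)) (or_intror erefl) x Kx; rewrite E.
have bigI' x : big B I' x -> (B (st_top s) `|` big B (st_dom s)) x.
  by move=> [y [Dy|->] By]; [right; exists y|left].
have cKB : conn e (big B K) by exact: (big_conn es mB).
have rK : B (st_root s) `<=` big B K by move=> z Bz; exists (st_root s).
pose c' i := State (st_rel (c i)) (st_dom (c i)) (st_top (c i)) (st_root (c i))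
  (fun x => big B (st_br (c i) x)).
have bigdom i : big (st_br (c' i)) (st_dom (c i)) `<=` big B (big (st_br (c i)) (st_dom (c i))).
  by move=> z [x cx [y yx Bz]]; exists y => //; exists x.
have bigdomI i : big (st_br (c i)) (st_dom (c i)) `<=` I'.
  by move=> z [x cx xz]; exact: dI cx _ xz.
have dKc i x : (st_dom (c i) `|` [set st_top (c i)]) x ->
    disj (big B K) (big B (st_br (c i) x)).
  by move=> cx; apply: (big_disj mB) => //; [exact: brI cx|exact: dK].
exists (big B K), c'; split.
  move=> i; have [[v1 v2 v3 v4 v5] hp] := vc i; split.
  - by split=> //; exact: (model_comp es mB es' v5).
  - by exists (st_top s).
  (* The new link is the old one together with the branch set of the tree vertex just created. *)
  - exists (J `|` big B K); split.
    + split; last by left.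
      by apply: connU => //; apply: touchS tJ.
    + by move=> z [/JI//|]; exact: (big_sub mB).
    + move=> x cx z [Jz [y /(brI _ _ cx) Iy Bz]|]; first exact: dJ Iy _ Jz Bz.
      exact: dKc cx z.
    + have : touch e (big B K) (big B (st_br (c i) (st_root (c i)))).
        by apply: (big_touch mB) => //; apply: dK; left.
      by apply: touchS => // z; right.
split=> /=.
- by split=> //; exact: bigS.
- by [].
- move=> i; split.
  + by move=> z Bz; exists (st_top s) => //; have [] := vc i.
  + by move=> z /(bigS (tI i))/bigI'.
  + move=> z [x cx [y yx Bz]]; exists y => //.
    have [//|E] := dI _ _ cx _ yx; case: (ndtop _ _ cx); by rewrite -E.
  + by move=> z Kz [x cx Bz]; apply: dKc Kz Bz; left.
  + by apply: dKc; right.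
- move=> i j ij; split.
  + move=> z [x cx Bz] [y cy Bz'].
    apply: (big_disj mB (dI _ _ cx) (dI _ _ cy)) Bz Bz'; exact: d2.
  + move=> z Bz [y cy Bz'].
    apply: (big_disj mB (tI i) (dI _ _ cy)) Bz Bz'; exact: d1.
- split=> [i|].
    by apply: (big_touch mB) => //; apply: dK; left; have [[]] := vc i.
  have [i ti] := tK2; exists i; apply: (big_touch mB) => //.
  by apply: dK; right.
Qed.

Lemma T_or_football_linked e I p q D r J : symr e -> conn_tied e p D -> D r -> enumerable D ->
  D `|` [set p] `<=` I -> conn e J -> J q -> J `<=` I -> disj J (D `|` [set p]) ->
  touch e J [set r] -> T_minor e I \/ football_minor e I p q.
Proof.
move=> es gD Dr cD DI cJ Jq JI dJ tJ.
have [|nF] := pselect (football_minor e I p q); first by right.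
(* Assuming that there is no such minor makes [football_or_step] applicable to every state; its
   expansions then build the minor after all. *)
left; apply: contrapT => nT; apply: (nT).
pose S := {s | linked e I p q s}.
have [_ _ nDp] := gD.
have s0 : S.
  exists (State e D p r (fun x => [set x])); split=> //=.
    by split=> //=; exact: model1.
  exists J; split=> //= x Dx z Jz zx; apply: dJ Jz _; by rewrite zx.
apply: (@T_minor_rec e I S (fun s => st_br (sval s) (st_top (sval s)))
  (fun s => big (st_br (sval s)) (st_dom (sval s)))
  (fun s => st_br (sval s) (st_root (sval s))) s0) => //.
- move=> [s [[_ [_ _ nd] _ _ mB] _ _]] /=; have [h inj _] := mB.
  have [cB BI] := h (st_top s) (or_intror erefl); split=> //.
  + by apply: (big_sub mB) => x; left.
  + move=> x Bx [y Dy By]; apply: nd; rewrite (inj _ y x _ _ Bx By) //; first by right.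
    by left.
- move=> [s ls]; have [[es' gs rs cs mB] _ _] := ls => /=.
  have nTs : ~ T_minor (st_rel s) (st_dom s `|` [set st_top s]).
    by move=> h; apply: nT; exact: T_minor_model mB h.
  have [h|h] := football_or_step es' gs cs rs nTs.
    by case: nF; exact: football_linked ls h.
  have [K [c [lc H]]] := linked_step es ls h.
  by exists K, (fun i => exist _ (c i) (lc i) : S).
Qed.

End Graphs.

(** * Reduction to countable graphs *)

(** Membership is a proposition because [V] is a bare type. *)
Fixpoint elem (V : Type) (x : V) (l : seq V) :=
  if l is y :: l' then x = y \/ elem x l' else False.

Lemma elem_cat (V : Type) (x : V) l l' : elem x l -> elem x (l ++ l').
Proof. by elim: l => //= y l IH [->|/IH]; [left|right]. Qed.

Lemma elem_catr (V : Type) (x : V) l l' : elem x l' -> elem x (l ++ l').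
Proof. by move=> h; elim: l => //= y l IH; right. Qed.

Lemma finite_elem (V : Type) (l : seq V) : finite_set [set x | elem x l].
Proof.
elim: l => [|y l IH] /=; first by rewrite (_ : mkset _ = set0) //; exact: finite_set0.
by rewrite (_ : mkset _ = [set y] `|` [set x | elem x l]) // finite_setU.
Qed.

Lemma finite_list (V : Type) (A : set V) : finite_set A ->
  exists l : seq V, forall x, A x <-> elem x l.
Proof.
move=> fA; have /finite_seqP[s Es] : finite_set (A : set {classic V}) by [].
exists s => x; rewrite Es /=; elim: s {Es} => //= y s [IH1 IH2].
by rewrite inE; split=> [/orP[/eqP->|/IH1]|[->|/IH2->]]; rewrite ?eqxx ?orbT; auto.
Qed.

(** Elements are named by finite trees, of which there are countably many: a leaf names a base
    element, and a node labelled [k] names entry [k] of [next] applied to the values of its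
    children. The default [base 0] already belongs to the closure. *)
Lemma countable_closure (V : Type) (base : nat -> V) (next : seq V -> seq V) :
  exists X : set V, [/\ enumerable X, forall n, X (base n) &
    forall l, (forall x, elem x l -> X x) -> forall y, elem y (next l) -> X y].
Proof.
pose g := fix g (t : GenTree.tree nat) : V := match t with
  | GenTree.Leaf n => base n
  | GenTree.Node k ts => nth (base 0) (next (map g ts)) k
  end.
exists (range g); split.
- exists (fun n => g (odflt (GenTree.Leaf 0) (unpickle n))) => _ [t _ <-].
  by exists (pickle t) => //; rewrite pickleK.
- by move=> n; exists (GenTree.Leaf n).
- move=> l lX y.
  have [ts <-] : exists ts, map g ts = l.
    elim: l lX => [|x l IH] lX; first by exists [::].
    have [|ts <-] := IH; first by move=> z zl; apply: lX; right.
    have [|t _ <-] := lX x; first by left.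
    by exists (t :: ts).
  have nthP (s : seq V) : elem y s -> exists k, nth (base 0) s k = y.
    elim: s => //= x s IH [->|/IH[k <-]]; first by exists 0.
    by exists k.+1.
  by move=> /nthP[k <-]; exists (GenTree.Node k ts).
Qed.

Fixpoint walk (V : Type) (e : V -> V -> Prop) (x : V) (l : seq V) (y : V) :=
  if l is z :: l' then e x z /\ walk e z l' y else x = y.

Lemma walk_rcons (V : Type) (e : V -> V -> Prop) x l y z :
  walk e x l y -> e y z -> walk e x (rcons l z) z.
Proof.
by elim: l x => [|w l IH] x /= => [->|[xw /IH h] yz] //; split=> //; exact: h.
Qed.

Lemma walk_inv (V : Type) (e : V -> V -> Prop) (B : set V) x l y :
  walk e x l y -> B x -> (forall a b, elem b l -> e a b -> B a -> B b) -> B y.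
Proof.
elim: l x => [|w l IH] x /= => [-> //|[xw /IH h] Bx cl].
apply: h => [|a b bl]; first by apply: (cl x) => //; left.
by apply: cl; right.
Qed.

(* A countable substructure closed under finding, for every finite list of
   vertices, a path to [{u, v}] that uses no edge inside that list. *)
Lemma countable_reduction (V : Type) (e : V -> V -> Prop) (C : set V) u v c d :
  symr e -> conn e C -> ~ C u -> ~ C v -> C c -> C d ->
  (forall A, A `<=` C -> A !=set0 ->
     infinite_set (cut e A ((C `\` A) `|` [set u; v]))) ->
  exists C', [/\ enumerable C', C' `<=` C /\ conn e C', C' c /\ C' d &
    forall A, A `<=` C' -> A !=set0 ->
      infinite_set (cut e A ((C' `\` A) `|` [set u; v]))].
Proof.
move=> es [_ cC] nCu nCv Cc Cd gC.
pose rC a b := e a b /\ C b.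
pose rl l a b := [/\ e a b, (C `|` [set u; v]) b & ~ (elem a l /\ elem b l)].
have w1 x : C x -> exists l, walk rC c l x.
  apply: (cC (fun x => exists l, walk rC c l x) c) => //; first by exists [::].
  by move=> a b Ca [l wl] Cb ab; exists (rcons l b); exact: (walk_rcons wl).
(* If no such walk exists, every edge leaving the set of vertices of [C] reachable from [x] has both
   ends in the finite list [l]. *)
have w2 l x : C x -> exists l' y, walk (rl l) x l' y /\ [set u; v] y.
  move=> Cx; apply: contrapT => n.
  pose A : set V := [set y | C y /\ exists l', walk (rl l) x l' y].
  have A0 : A !=set0 by exists x; split=> //; exists [::].
  have AC : A `<=` C by move=> y [].
  apply: (gC A AC A0).
  apply: (@sub_finite_set _ _ ([set x | elem x l] `*` [set x | elem x l])); last first.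
    by apply: finite_setX; exact: finite_elem.
  move=> [a b] [/= [Ca [l' wl']] H ab]; apply: contrapT => nab.
  have rab : rl l a b by split=> //; case: H => [[? _]|?]; [left|right].
  have wb := walk_rcons wl' rab.
  case: H => [[Cb nAb]|uvb]; first by apply: nAb; split=> //; exists (rcons l' b).
  by apply: n; exists (rcons l' b), b.
(* The head [x] is the vertex to be linked, to [c] by the first walk and to [{u, v}] by the second;
   edges with both ends in the list are forbidden to the second walk only. *)
have /choice[next nextP] l : exists l', if l is x :: _ then C x ->
    (exists2 l1, (forall y, elem y l1 -> elem y l') & walk rC c l1 x) /\
    (exists l2 y, [/\ forall z, elem z l2 -> elem z l', walk (rl l) x l2 y &
       [set u; v] y]) else True.
  case: l => [|x l]; first by exists [::].
  have [Cx|nCx] := pselect (C x); last by exists [::] => /nCx.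
  have [l1 h1] := w1 x Cx; have [l2 [y [h2 uvy]]] := w2 (x :: l) x Cx.
  exists (l1 ++ l2) => _; split.
    by exists l1 => // z; exact: elem_cat.
  by exists l2, y; split=> // z; exact: elem_catr.
pose base n := if n is 0 then c else if n is 1 then d else if n is 2 then u else v.
have [X [cX bX nX]] := countable_closure base next.
have CX0 : (X `&` C) c by split=> //; exact: (bX 0).
exists (X `&` C); split.
- by have [f fX] := cX; exists f => x [/fX].
- split; first by move=> x [].
  apply: (@conn_intro _ _ es _ c) => // B Bc cl x [Xx Cx].
  have [[l1 l1n wl1] _] := nextP [:: x] Cx.
  have Xl1 y : elem y l1 -> X y.
    by move=> /l1n; apply: nX => z /= [->|].
  suff [] : (B `&` (X `&` C)) x by [].
  apply: (walk_inv wl1) => // a b bl [ab Cb] [Ba CXa].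
  have CXb : (X `&` C) b by split=> //; exact: Xl1.
  by split=> //; exact: (cl a b).
- by split=> //; split=> //; exact: (bX 1).
- move=> A AX A0 fin; have [x Ax] := A0; have [Xx Cx] := AX _ Ax.
  (* The list of [x] and all ends of the supposedly finite boundary of [A] yields a walk from [x] to
     [{u, v}] in the closure that avoids this boundary, so it could never leave [A]. *)
  have [l1 hl1] := finite_list (finite_image (fun z => z.1) fin).
  have [l2 hl2] := finite_list (finite_image (fun z => z.2) fin).
  have l12X y : elem y (x :: l1 ++ l2) -> X y.
    move=> /= [->//|].
    have cases : forall l l', elem y (l ++ l') -> elem y l \/ elem y l'.
      by elim=> [|z l IH] l' /=; [right|move=> [->|/IH[]]; auto].
    move=> /cases[/hl1[[a b] [/= Aa _ _] <-]|/hl2[[a b] [/= _ Bb _] <-]].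
      by have [] := AX _ Aa.
    by case: Bb => [[[]]//|[->|->]]; [exact: (bX 2)|exact: (bX 3)].
  have [_ [l' [y [l'n wl' uvy]]]] := nextP (x :: l1 ++ l2) Cx.
  have nCy : ~ C y by case: uvy => ->.
  apply: nCy; apply: (AX y _).2; apply: (walk_inv wl') => // a b bl' [ab CUb nab] Aa.
  apply: contrapT => nAb.
  have Xb : X b by apply: nX (l'n _ bl').
  have Fab : cut e A (((X `&` C) `\` A) `|` [set u; v]) (a, b).
    by split=> //=; case: CUb => [Cb|]; [left|right].
  apply: nab; split; right.
    by apply: elem_cat; apply/hl1; exists (a, b).
  by apply: elem_catr; apply/hl2; exists (a, b).
Qed.

Lemma football_minor_sym (V : Type) (e : V -> V -> Prop) I p q :
  football_minor e I p q -> football_minor e I q p.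
Proof.
move=> [e' [I' [B [a [b [m [ab [Ia Ib]] [Ba Bb] i1 i2]]]]]].
exists e', I', B, b, a; split=> //; last by rewrite setUC.
by split; [move=> E; apply: ab|].
Qed.

(** If [C] is not tied to [u], it contains a connected [Q] with finite boundary towards [C \ Q] and
    [u]. Then [Q] is tied to [v], and [u] is linked to it through the rest of [C], so the two ends
    exchange roles. *)
Lemma T_or_football_countable (V : Type) (e : V -> V -> Prop) C u v c d : symr e ->
  u <> v -> enumerable C -> conn e C -> ~ C u -> ~ C v -> C c -> C d -> e u c -> e v d ->
  (forall A, A `<=` C -> A !=set0 ->
     infinite_set (cut e A ((C `\` A) `|` [set u; v]))) ->
  T_minor e (C `|` [set u; v]) \/ football_minor e (C `|` [set u; v]) u v.
Proof.
move=> es uv cntC cC nCu nCv Cc Cd uc vd gC; set I := C `|` [set u; v].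
have CI : C `<=` I by move=> x; left.
have Iu : I u by right; left.
have Iv : I v by right; right.
have [gu|ngu] := pselect (tied e u C).
  apply: (@T_or_football_linked V e I u v C d [set v]) => //.
  - by move=> x [/CI|->].
  - exact: conn1.
  - by move=> _ ->.
  - by move=> _ -> [|E] //; apply: uv.
  - by exists v, d.
have [A [AC [x Ax] fA]] : exists A, [/\ A `<=` C, A !=set0 &
    finite_set (cut e A ((C `\` A) `|` [set u]))].
  apply: contrapT => n; apply: ngu => A AC A0 fin; apply: n; by exists A.
pose Q := compon e A x.
have QA : Q `<=` A by exact: compon_sub.
have Qx : Q x by exact: compon_refl.
have QC : Q `<=` C by move=> y /QA/AC.
have fQ : finite_set (cut e Q ((C `\` Q) `|` [set u])).
  apply: sub_finite_set fA => -[a b] [/= Qa H ab]; split=> //=; first exact: QA.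
  case: H => [[Cb nQb]|]; [left; split=> // Ab; apply: nQb|by right].
  exact: compon_closed ab.
have gQ : tied e v Q.
  move=> B BQ B0 fin; have BC : B `<=` C by move=> y /BQ/QC.
  apply: (gC B BC B0); apply: (@sub_finite_set _ _
    (cut e B ((Q `\` B) `|` [set v]) `|` cut e Q ((C `\` Q) `|` [set u]))).
    move=> [a b] [/= Ba H ab].
    have [Qb|nQb] := pselect (Q b).
      by left; split=> //=; left; split=> // Bb; case: H => [[]//|[E|E]];
        rewrite E in Qb; have := QC _ Qb.
    case: H => [[Cb nBb]|[E|E]].
    - by right; split=> //=; [exact: BQ|left].
    - by right; split=> //=; [exact: BQ|right].
    - by left; split=> //=; right.
  by rewrite finite_setU.
have cu : conn e [set u] by exact: conn1.
have tuC : touch e [set u] C by exists u, c.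
have dLE : disj [set u] C by move=> _ ->.
have Q0 : Q !=set0 by exists x.
have [J [cJ uJ JC [j [r [Jj Qr jr]]]]] := link es cu cC tuC QC Q0 dLE.
have [|||||||h|h] := @T_or_football_linked V e I v u Q r J es _ Qr _ _ cJ _ _ _.
- by split=> //; [exact: conn_compon|move=> /QC].
- exact: enumerableS QC cntC.
- by move=> y [/QC/CI|->].
- exact: uJ.
- by move=> y /JC[->|[/CI]].
- move=> y /JC[->|[Cy nQy]] [Qy|yv] //; first by have := QC _ Qy.
  by rewrite yv in Cy.
- by exists j, r.
- by left.
- by right; exact: football_minor_sym.
Qed.

(** * Translation to the type of graphs *)

Lemma sval_inj (V : Type) (P : V -> Prop) (x y : {x | P x}) : sval x = sval y -> x = y.
Proof.
case: x y => [x hx] [y hy] /= E; subst y; congr exist; exact: Prop_irrelevance.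
Qed.

Lemma joined_inv (G : graph) (B : set G) x y :
  (forall a b : G, adj a b -> B a -> B b) -> joined x y -> B x -> B y.
Proof.
move=> cl; elim=> {x y} [x y|x|x y z _ IH1 _ IH2] //; first exact: cl.
by move=> /IH1/IH2.
Qed.

Lemma conn_connected (G : graph) (A : set G) : conn (@adj G) A -> connected (induced A).
Proof.
move=> [[x0 Ax0] cA]; split; first by exists (exist _ x0 Ax0).
move=> x y.
pose B : set G := [set z | forall y : induced A, sval y = z -> joined x y].
apply: (cA B (sval x) (svalP x) _ _ _ (svalP y)) => //.
  by move=> y' /sval_inj->; exact: Relation_Operators.rt_refl.
move=> a b Aa Ba Ab ab y' Ey.
apply: (Relation_Operators.rt_trans _ _ _ (exist _ a Aa : induced A)).
  exact: Ba.
by apply: Relation_Operators.rt_step; rewrite /= /induced_adj /= Ey.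
Qed.

Lemma connected_conn (G : graph) (A : set G) : connected (induced A) -> conn (@adj G) A.
Proof.
move=> [[[x0 Ax0] _] cA]; split; first by exists x0.
move=> B x Ax Bx cl y Ay.
apply: (@joined_inv _ (fun z : induced A => B (sval z)) (exist _ x Ax)
  (exist _ y Ay)) => //.
by move=> a b ab Ba; apply: (cl (sval a)) => //; exact: svalP.
Qed.

Lemma conn_induced (G : graph) (W A : set G) : A `<=` W -> conn (@adj G) A ->
  conn (@adj (induced W)) [set x | A (sval x)].
Proof.
move=> AW [[a Aa] cA]; split; first by exists (exist _ a (AW _ Aa)).
move=> B x /= Ax Bx cl y /= Ay.
pose B' : set G := [set z | forall h : W z, B (exist _ z h)].
have : B' (sval y).
  apply: (cA B' (sval x)) => //.
    by move=> h; rewrite (_ : exist _ _ _ = x) //; exact: sval_inj.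
  move=> b c Ab B'b Ac bc h.
  by apply: (cl (exist _ b (AW _ Ab)) (exist _ c h)) => //; exact: B'b.
by move=> /(_ (svalP y)); rewrite (_ : exist _ _ _ = y) //; exact: sval_inj.
Qed.

Lemma model_is_model (G : graph) (W I : set G) (H : graph) (e' : G -> G -> Prop)
    (I' : set G) (B : G -> set G) (f : H -> G) : I `<=` W ->
  model (@adj G) I e' I' B -> (forall h, I' (f h)) -> injective f ->
  (forall h h', adj h h' -> f h <> f h' -> e' (f h) (f h')) ->
  @is_model H (induced W) (fun h => [set x | B (f h) (sval x)]).
Proof.
move=> IW [cB inj t] If finj fe.
have BW h : B (f h) `<=` W by move=> x; have [_ BI] := cB _ (If h); move=> /BI/IW.
split.
- move=> h; have [[[x Bx] _] _] := cB _ (If h).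
  by exists (exist _ x (BW h _ Bx)).
- move=> h h' _ _ [x [/= Bx Bx']]; apply: finj; exact: inj Bx Bx'.
- move=> h; apply: conn_connected; apply: conn_induced; first exact: BW.
  exact: (cB _ (If h)).1.
- move=> h h' hh'.
  have ne : f h <> f h'.
    by move=> /finj E; rewrite E in hh'; exact: adj_irrefl hh'.
  have [a [b [Ba Bb ab]]] := t _ _ (If h) (If h') ne (fe _ _ hh' ne).
  by exists (exist _ a (BW h _ Ba)), (exist _ b (BW h' _ Bb)).
Qed.

(** * The tree of finite sequences *)

Definition seq_adj (s s' : seq nat) : Prop :=
  (exists i, s' = rcons s i) \/ (exists i, s = rcons s' i).

Lemma seq_adj_sym s s' : seq_adj s s' -> seq_adj s' s.
Proof. by move=> [h|h]; [right|left]. Qed.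

Lemma seq_adj_irrefl s : ~ seq_adj s s.
Proof. by move=> [] [i /(congr1 size)]; rewrite size_rcons => /n_Sn. Qed.

Definition seq_tree : graph := Graph seq_adj_sym seq_adj_irrefl.

Lemma seq_adj_parent (s s' : seq nat) : seq_adj s s' -> size s' <= size s ->
  exists i, s = rcons s' i.
Proof. by move=> [[i ->]|//]; rewrite size_rcons ltnn. Qed.

(* A longest vertex of a cycle would have two parents. *)
Lemma seq_tree_acyclic : acyclic seq_tree.
Proof.
move=> [n [c [cinj cadj]]].
have [k _ kmax] := @arg_maxnP _ (@ord0 n.+2) predT (fun i => size (c i : seq nat)) isT.
have [i Ei] : exists i, c k = rcons (c (ordS k)) i.
  by apply: seq_adj_parent; [exact: cadj|exact: kmax].
have [j Ej] : exists i, c k = rcons (c (ord_pred k)) i.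
  apply: seq_adj_parent; last exact: kmax.
  by apply: seq_adj_sym; rewrite -{2}(ord_predK k); exact: cadj.
have /cinj E : c (ordS k) = c (ord_pred k).
  by have [-> _] := rcons_inj (etrans (esym Ei) Ej).
(* Two steps around a cycle of length at least three cannot return to [k]; the three cases treat the
   wrap-around. *)
have : ordS (ordS k) = k by rewrite E ord_predK.
move=> /(congr1 val) /=; have := ltn_ord k.
case: (ltngtP k n.+1) => kn kn3.
- rewrite (@modn_small k.+1 n.+3 (leqW kn)) (@modn_small k.+2 n.+3 kn) => E'.
  by have := leqnSn k.+1; rewrite E' ltnn.
- have -> : nat_of_ord k = n.+2 by apply/eqP; rewrite eqn_leq -ltnS kn3.
  by rewrite modnn modn_small.
- by rewrite kn (@modn_small n.+2) // modnn.
Qed.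

Lemma seq_tree_is_T_aleph0 : is_T_aleph0 seq_tree.
Proof.
split; first split.
- have nilP (s : seq nat) : @joined seq_tree [::] s /\ @joined seq_tree s [::].
    elim/last_ind: s => [|s i [IH1 IH2]].
      by split; exact: Relation_Operators.rt_refl.
    split.
      apply: (Relation_Operators.rt_trans _ _ _ _ _ IH1).
      by apply: Relation_Operators.rt_step; left; exists i.
    apply: (Relation_Operators.rt_trans _ _ _ _ _ _ IH2).
    by apply: Relation_Operators.rt_step; right; exists i.
  split; first by exists [::].
  move=> s s'.
  exact: (Relation_Operators.rt_trans _ _ _ _ _ (nilP s).2 (nilP s').1).
- exact: seq_tree_acyclic.
- move=> s; apply: (@eq_card_nat (seq nat)); first exact: countableP.
  move=> fin; apply: infinite_nat.
  apply: (finite_set_inj (f := rcons s)) fin => [i _|i j _ _ /rcons_inj[]//].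
  by left; exists i.
Qed.

Lemma T_minor_has (G : graph) (W I : set G) : I `<=` W ->
  T_minor (@adj G) I -> has_T_aleph0_t_minor (induced W).
Proof.
move=> IW [K [t [cK [ct tI] [dK dt] tK tt]]].
exists seq_tree; split; first exact: seq_tree_is_T_aleph0.
pose B (o : option (seq nat)) := if o is Some s then K s else t.
have cB o : conn (@adj G) (B o) /\ B o `<=` I by case: o => [s|] //; exact: cK.
exists (fun o : cone seq_tree => [set x : induced W | B o (sval x)]).
have BW o : B o `<=` W by move=> x /(cB o).2/IW.
split.
- move=> o; have [[[x Bx] _] _] := cB o; by exists (exist _ x (BW o _ Bx)).
- move=> o o' _ _ [x [/= Bx Bx']]; case: o o' Bx Bx' => [s|] [s'|] //= Bx Bx'.
  + by apply: contrapT => ne; apply: (dK s s') Bx Bx' => E; apply: ne; rewrite E.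
  + by have := dt _ _ Bx' Bx.
  + by have := dt _ _ Bx Bx'.
- move=> o; apply: conn_connected; apply: conn_induced; first exact: BW.
  exact: (cB o).1.
- have lift o o' : touch (@adj G) (B o) (B o') ->
      exists x y : induced W, [/\ B o (sval x), B o' (sval y) & adj x y].
    move=> [a [b [Ba Bb ab]]].
    by exists (exist _ a (BW o _ Ba)), (exist _ b (BW o' _ Bb)).
  have ts := touch_sym (@adj_sym G).
  move=> o o' h; apply: (lift o o'); case: o o' h => [s|] [s'|] //= h.
  + by case: h => [[i ->]|[i ->]] //; exact: ts.
  + exact: ts.
Qed.

Section Football.
Variables (V : Type) (e : V -> V -> Prop) (es : symr e).

Definition simple_adj (x y : V) := x <> y /\ e x y.

Lemma simple_adj_sym x y : simple_adj x y -> simple_adj y x.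
Proof. by move=> [xy /es exy]; split=> // E; apply: xy. Qed.

Lemma simple_adj_irrefl x : ~ simple_adj x x.
Proof. by case. Qed.

Definition simple_graph : graph := Graph simple_adj_sym simple_adj_irrefl.

Lemma icut_simple X : icut e X -> icut (@adj simple_graph) X.
Proof.
move=> iX A AX A0 XA0; apply: sub_infinite_set (iX A AX A0 XA0).
move=> [a b] [/= Aa [Xb nAb] ab]; split=> //; split=> //= E.
by rewrite E in Aa.
Qed.

End Football.

Lemma icut_induced (G : graph) (W X : set G) : X `<=` W -> icut (@adj G) X ->
  icut (@adj (induced W)) [set x | X (sval x)].
Proof.
move=> XW iX A AX [a Aa] [b [Xb nAb]] fin.
apply: (iX [set sval x | x in A]).
- by move=> _ [x /AX Xx <-].
- by exists (sval a), a.
- by exists (sval b); split=> // -[x Ax /sval_inj E]; rewrite E in Ax.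
apply: sub_finite_set (finite_image (fun z => (sval z.1, sval z.2)) fin).
move=> [c d] [/= [x Ax <-] [Xd nAd] cd].
have y : {y : induced W | sval y = d} by exists (exist _ d (XW _ Xd)).
case: y => y yd; exists (x, y); last by rewrite /= yd.
split=> //=; last by rewrite /induced_adj yd.
by split; [rewrite yd|move=> Ay; apply: nAd; exists y].
Qed.

(** If deleting [F] separated [x] from [y], the vertices still reachable from [x] would have an
    infinite boundary contained in [F]. *)
Lemma icut_infinitely_edge_connected (G : graph) (A : set G) :
  icut (@adj G) A -> infinitely_edge_connected (induced A).
Proof.
move=> iA x y xy F FE fF; apply: contrapT => nj.
pose S : set G :=
  [set z | exists h : A z, @joined (del_edges F) x (exist _ z h)].
apply: (iA S).
- by move=> z [].
- exists (sval x), (svalP x).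
  rewrite (_ : exist _ _ _ = x); last exact: sval_inj.
  exact: Relation_Operators.rt_refl.
- exists (sval y); split; first exact: svalP.
  by move=> [h]; rewrite (_ : exist _ _ _ = y) //; exact: sval_inj.
(* An ordered pair is sent to its edge; this is injective on the cut, because the first entry lies
   in [S] and the second does not. *)
apply: (finite_set_inj
  (f := fun z => [set w : induced A | sval w = z.1 \/ sval w = z.2])) fF.
- move=> [a b] [/= [ha ja] [hb nSb] ab].
  apply: contrapT => nF; apply: nSb; exists hb.
  apply: (Relation_Operators.rt_trans _ _ _ _ _ ja).
  apply: Relation_Operators.rt_step; split=> // Fab; apply: nF.
  suff -> : [set w : induced A | sval w = a \/ sval w = b] =
    [set (exist _ a ha : induced A); exist _ b hb] by [].
  apply/seteqP; split=> w /=; last by move=> [->|->]; [left|right].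
  by move=> [E|E]; [left|right]; exact: sval_inj.
- move=> [a b] [c d] [/= Sa [Ab nSb] _] [/= Sc [Ad nSd] _] E.
  have [ha _] := Sa; have [hc _] := Sc.
  have Ea : [set w : induced A | sval w = c \/ sval w = d] (exist _ a ha).
    by rewrite -E; left.
  have Eb : [set w : induced A | sval w = c \/ sval w = d] (exist _ b Ab).
    by rewrite -E; right.
  case: Ea => /= [ac|ad]; last by rewrite ad in Sa.
  case: Eb => /= [bc|bd]; first by rewrite bc in nSb.
  by rewrite ac bd.
Qed.

Lemma football_minor_has (G : graph) (u v : G) (C : set (del_vertices [set u; v]%classic))
    (I : set G) : I `<=` with_ends C -> football_minor (@adj G) I u v ->
  has_football_minor_connecting (endl C) (endr C).
Proof.
move=> IW [e' [I' [B [a [b [[es' mB] [ab [Ia Ib]] [Ba Bb] i1 i2]]]]]].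
pose F := @induced (simple_graph es') I'.
exists F, (exist _ a Ia : F), (exist _ b Ib : F),
  (fun h : F => [set x | B (sval h) (sval x)]); split.
- split.
  + by move=> /(congr1 sval).
  + by apply: icut_infinitely_edge_connected; exact: icut_simple.
  + apply: icut_infinitely_edge_connected.
    have := @icut_induced (simple_graph es') I' _ _ (@icut_simple _ _ es' _ i2).
    rewrite (_ : [set x | _] = ~` [set exist _ a Ia; exist _ b Ib]).
      by apply; move=> x [].
    apply/seteqP; split=> x /=.
      by move=> [_ nab] [E|E]; apply: nab; rewrite E; [left|right].
    move=> nab; split; first exact: svalP.
    by move=> [E|E]; apply: nab; [left|right]; exact: sval_inj.
- apply: (model_is_model IW mB) => [h||h h' [//]]; first exact: svalP.
  by move=> x y; exact: sval_inj.
- by left.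
Qed.

Theorem theorem5p13 (G : graph) (hG : infinitely_edge_connected G)
  (u v : G) (huv : u <> v)
  (C : set (del_vertices [set u; v]%classic)) (hC : is_component C)
  (hu : exists c, C c /\ adj u (sval c))
  (hv : exists c, C c /\ adj v (sval c)) :
  has_T_aleph0_t_minor (induced (with_ends C)) \/
  has_football_minor_connecting (endl C) (endr C).
Proof.
have [c [Cc uc]] := hu; have [d [Cd vd]] := hv; have [cC maxC] := hC.
pose H := del_vertices [set u; v].
pose C0 : set G := sval @` C.
have esG : symr (@adj G) by move=> x y; exact: adj_sym.
have esH : symr (@adj H) by move=> x y; exact: adj_sym.
have C0uv x : C0 x -> ~ [set u; v] x by move=> [y _ <-]; exact: (svalP y).
have nu : ~ C0 u by move=> /C0uv; apply; left.
have nv : ~ C0 v by move=> /C0uv; apply; right.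
have cC0 : conn (@adj G) C0.
  have [[x Cx] cH] := connected_conn cC; split; first by exists (sval x), x.
  move=> B _ [y Cy <-] By cl _ [z Cz <-].
  apply: (cH (fun w => B (sval w)) y) => // a b Ca Ba Cb ab.
  by apply: (cl (sval a)) => //; [exists a|exists b].
(* Adding an adjacent vertex keeps [C] connected, so by maximality it already belongs to [C]. *)
have C0cl a b : C0 a -> adj a b -> ~ [set u; v] b -> C0 b.
  move=> [x Cx <-] xb nb; pose b' : H := exist _ b nb; exists b' => //.
  rewrite -(maxC (C `|` [set b'])); [by right|by move=> y; left|].
  apply: conn_connected; apply: connU => //; [exact: connected_conn|exact: conn1|].
  by exists x, b'.
(* Deleting a finite boundary of [A] would separate a vertex of [A] from [u]. *)
have gC0 A : A `<=` C0 -> A !=set0 ->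
    infinite_set (cut (@adj G) A ((C0 `\` A) `|` [set u; v])).
  move=> ACsub [a Aa] fin.
  pose F : set (set G) := [set [set z.1; z.2] | z in
    cut (@adj G) A ((C0 `\` A) `|` [set u; v])].
  have FE : F `<=` edges G by move=> _ [[x y] [/= _ _ xy] <-]; exists x, y.
  have au : a <> u by move=> E; apply: nu; rewrite -E; exact: ACsub.
  have := hG _ _ au F FE (finite_image _ fin).
  move=> /(@joined_inv (del_edges F) A) => /(_ _ Aa) Au.
  apply: nu; apply: (ACsub _ _); apply: Au => x y [xy nF] Ax; apply: contrapT => nAy.
  apply: nF; exists (x, y) => //; split=> //=.
  have [uvy|nuvy] := pselect ([set u; v] y); first by right.
  by left; split=> //; apply: C0cl xy nuvy; exact: ACsub.
have C0c : C0 (sval c) by exists c.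
have C0d : C0 (sval d) by exists d.
have [C' [cntC' [CC cC'] [C'c C'd] gC']] :=
  countable_reduction esG cC0 nu nv C0c C0d gC0.
have IW : C' `|` [set u; v] `<=` with_ends C.
  by move=> x [/CC|]; [left|right].
have [||h|h] := @T_or_football_countable G (@adj G) C' u v (sval c) (sval d)
    esG huv cntC' cC' _ _ C'c C'd uc vd gC'.
- by move=> /CC.
- by move=> /CC.
- by left; exact: T_minor_has h.
- by right; exact: football_minor_has h.
Qed.
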